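(* Let $(\Omega,\mathcal F,\mathbb P,\theta)$ be a probability space with an invertible (measurable inverse), ergodic, $\mathbb P$-preserving map $\theta$, and let $\omega\mapsto\mathcal V_\omega=(\mathcal T_{a;\omega})_{a\in\mathcal A}$ be a random instrument as described in the context. Assume: (ESP) for $\mathbb P$-a.e. $\omega\in\Omega$ there is an integer $N_0(\omega)\in\mathbb N$ such that $\Phi^{(n)}_\omega$ is strictly positive for all $n\ge N_0(\omega)$. Then there exists a unique dynamically stationary state $\mathfrak s:\Omega\to\mathcal S_d$, i.e. a measurable map with $\Phi^{(n)}_\omega(\mathfrak s(\omega))=\mathfrak s(\theta^n\omega)$ for all $n\in\mathbb N$ ($\mathbb P$-a.s.). Moreover, for every random initial state $\vartheta:\Omega\to\mathcal S_d$, $\mathbb Q_{\vartheta(\omega);\omega}\ll\mathbb Q_{\mathfrak s(\omega);\omega}$ for $\mathbb P$-a.e. $\omega$. If in addition $\rho_{\mathbb P}(n)\to0$ as $n\to\infty$, then for every $\delta>0$ there exists a deterministic sequence $(r_n)_{n\ge1}\subseteq[0,\infty)$ with $\sum_{n\ge1}r_n^{\delta/(2+\delta)}<\infty$ such that for every random initial state $\vartheta:\Omega\to\mathcal S_d$ and every $n\in\mathbb N$, $$\beta_n(\vartheta):=\mathbb E_{\mathbb P}\Big[\big\|\Phi^{(n)}_\omega(\vartheta(\omega))-\mathfrak s(\theta^n\omega)\big\|_1\Big]\le r_n .$$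
   Context: Let $d\in\mathbb N$, $\mathcal H=\mathbb C^d$, $M_d$ the $d\times d$ complex matrices with trace norm $\|X\|_1=\operatorname{tr}|X|$, and $\mathcal S_d=\{\rho\in M_d:\rho\ge0,\ \operatorname{tr}\rho=1\}$ the set of states. A linear map $\phi:M_d\to M_d$ is strictly positive if it maps every nonzero positive semidefinite matrix to a positive definite matrix. Let $\mathcal A$ be a finite outcome set and $(\mathcal A^{\mathbb N},\Sigma)$ the sequence space with its product $\sigma$-algebra and coordinates $A_n(\bar a)=a_n$. A random instrument on $(\Omega,\mathcal F,\mathbb P)$ is a family $\mathcal T_{a;\omega}:M_d\to M_d$ ($a\in\mathcal A$, $\omega\in\Omega$) of completely positive, trace-non-increasing linear maps such that $\omega\mapsto\mathcal T_{a;\omega}$ is measurable for each $a$ and $\Phi_\omega:=\sum_{a}\mathcal T_{a;\omega}$ is trace preserving for $\mathbb P$-a.e. $\omega$. Put $\Phi_{k;\omega}:=\sum_a\mathcal T_{a;\theta^k\omega}$ and $\Phi^{(n)}_\omega:=\Phi_{n;\omega}\circ\cdots\circ\Phi_{1;\omega}$. For $\rho\in\mathcal S_d$ and $\omega\in\Omega$, the quenched law $\mathbb Q_{\rho;\omega}$ is the unique probability measure on $(\mathcal A^{\mathbb N},\Sigma)$ with $\mathbb Q_{\rho;\omega}(A_1=a_1,\dots,A_n=a_n)=\operatorname{tr}\big[(\mathcal T_{a_n;\theta^n\omega}\circ\cdots\circ\mathcal T_{a_1;\theta\omega})(\rho)\big]$. A random initial state is a measurable map $\vartheta:\Omega\to\mathcal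 S_d$. Mixing: let $\mathcal F_k:=\sigma(\omega\mapsto\mathcal V_{\theta^j\omega}: j\le k)$ and $\mathcal F^k:=\sigma(\omega\mapsto\mathcal V_{\theta^j\omega}: j\ge k)$; for sub-$\sigma$-algebras $\mathcal B,\mathcal C$, $\rho_{\mathbb P}(\mathcal B,\mathcal C)=\sup\{|\mathrm{Corr}_{\mathbb P}(U,V)|: U\in L^2(\mathcal B),V\in L^2(\mathcal C)\text{ nonconstant}\}$, and $\rho_{\mathbb P}(n):=\sup_{k\in\mathbb N}\rho_{\mathbb P}(\mathcal F_k,\mathcal F^{k+n})$. *)

(* Defs.v *)
From HB Require Import structures.
From mathcomp Require Import all_boot all_order all_algebra.
From mathcomp Require Import complex.
From mathcomp Require Import all_classical all_reals all_analysis.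

Set Implicit Arguments.
Unset Strict Implicit.
Unset Printing Implicit Defensive.

Import Order.TTheory GRing.Theory Num.Theory.
Local Open Scope classical_set_scope.
Local Open Scope ring_scope.

(* Sequence space A^N (coordinates indexed by nat: coordinate i is A_{i+1}).
   The witness a0 only serves to equip the type with a point, which the
   measure-theory library requires (A is nonempty in any case).             *)
Definition seqsp (A : finType) (a0 : A) : Type := nat -> A.
Arguments seqsp {A} a0.
HB.instance Definition _ (A : finType) (a0 : A) :=
  Choice.on (seqsp a0).
HB.instance Definition _ (A : finType) (a0 : A) :=
  isPointed.Build (seqsp a0) (fun _ => a0).

Definition coordG (A : finType) (a0 : A) : set (set (seqsp a0)) :=
  [set S | exists (n : nat) (B : set A), S = (fun x : seqsp a0 => x n) @^-1` B].

Arguments coordG {A} a0.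

Definition seqMeas (A : finType) (a0 : A) := g_sigma_algebraType (coordG a0).
Arguments seqMeas {A} a0.

Definition cyl (A : finType) (a0 : A) (w : nat -> A) (n : nat) : set (seqMeas a0) :=
  [set x : seqsp a0 | forall i : nat, (i < n)%N -> x i = w i].
Arguments cyl {A} a0 w n.

Section QuantumDefs.
Context {R : realType}.
Local Notation C := R[i].

Definition ctr m n (M : 'M[C]_(m, n)) : 'M[C]_(n, m) := \matrix_(i, j) (M j i)^*.

Definition psd n (M : 'M[C]_n) : Prop :=
  forall v : 'cV[C]_n, 0 <= (ctr v *m M *m v) 0 0.
Definition pd n (M : 'M[C]_n) : Prop :=
  forall v : 'cV[C]_n, v != 0 -> 0 < (ctr v *m M *m v) 0 0.

Definition is_state d (rho : 'M[C]_d) : Prop := psd rho /\ \tr rho = 1.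

Definition mabs d (X : 'M[C]_d) : 'M[C]_d :=
  xget 0 [set P : 'M[C]_d | psd P /\ P *m P = ctr X *m X].
Definition tnorm d (X : 'M[C]_d) : R := complex.Re (\tr (mabs X)).

Definition strictly_positive d (f : 'M[C]_d -> 'M[C]_d) : Prop :=
  forall M, psd M -> M != 0 -> pd (f M).

(* complete positivity: id_k (x) f is positive for every k, where an element
   of M_k (x) M_d = M_k(M_d) is written as the block matrix of its blocks *)
Definition completely_positive d (f : 'M[C]_d -> 'M[C]_d) : Prop :=
  forall (k : nat) (X : 'I_k -> 'I_k -> 'M[C]_d),
    psd (\mxblock_(i < k, j < k) X i j) ->
    psd (\mxblock_(i < k, j < k) f (X i j)).

Definition trace_nonincreasing d (f : 'M[C]_d -> 'M[C]_d) : Prop :=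
  forall rho, psd rho -> \tr (f rho) <= \tr rho.

Definition trace_preserving d (f : 'M[C]_d -> 'M[C]_d) : Prop :=
  forall X, \tr (f X) = \tr X.

End QuantumDefs.

Section DynDefs.
Context {R : realType} {dO : measure_display} {Omega : measurableType dO}.
Local Notation C := R[i].
Variables (d : nat) (A : finType) (theta : Omega -> Omega)
  (T : A -> Omega -> 'M[C]_d -> 'M[C]_d).

Definition mx_measurable (M : Omega -> 'M[C]_d) : Prop :=
  forall i j, measurable_fun setT (fun w => complex.Re (M w i j)) /\
              measurable_fun setT (fun w => complex.Im (M w i j)).

Definition PhiK (k : nat) (w : Omega) (X : 'M[C]_d) : 'M[C]_d :=
  \sum_(a : A) T a (iter k theta w) X.

Fixpoint Phin (n : nat) (w : Omega) (X : 'M[C]_d) : 'M[C]_d :=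
  match n with
  | 0 => X
  | m.+1 => PhiK m.+1 w (Phin m w X)
  end.

(* (T_{a_n; theta^n omega} o ... o T_{a_1; theta omega}) (rho), with a_{i+1} = s i *)
Fixpoint Tseq (s : nat -> A) (n : nat) (w : Omega) (rho : 'M[C]_d) : 'M[C]_d :=
  match n with
  | 0 => rho
  | m.+1 => T (s m) (iter m.+1 theta w) (Tseq s m w rho)
  end.

Definition is_quenched_law (a0 : A) (rho : 'M[C]_d) (w : Omega)
    (Q : probability (seqMeas a0) R) : Prop :=
  forall (s : nat -> A) (n : nat),
    \tr (Tseq s n w rho) = Complex (fine (Q (cyl a0 s n))) 0.

Definition random_state (vt : Omega -> 'M[C]_d) : Prop :=
  mx_measurable vt /\ forall w, is_state (vt w).

Definition dyn_stationary (P : probability Omega R) (s : Omega -> 'M[C]_d) : Prop :=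
  random_state s /\
  {ae P, forall w, forall n : nat, Phin n w (s w) = s (iter n theta w)}.

End DynDefs.
Arguments is_quenched_law {R dO Omega d A} theta T a0 rho w Q.

Section Mixing.
Context {R : realType} {dO : measure_display} {Omega : measurableType dO}.
Local Notation C := R[i].
Variables (P : probability Omega R) (d : nat) (A : finType)
  (theta thetainv : Omega -> Omega) (T : A -> Omega -> 'M[C]_d -> 'M[C]_d).

Definition thetaZ (j : int) : Omega -> Omega :=
  match j with
  | Posz n => iter n theta
  | Negz n => iter n.+1 thetainv
  end.

(* generators of sigma(omega |-> V_{theta^j omega} : j in J): preimages of Borel
   sets under the real/imaginary parts of the entries of T_{a;theta^j omega}(X) *)
Definition instrG (J : set int) : set (set Omega) :=
  [set S | exists (j : int) (a : A) (X : 'M[C]_d) (p q : 'I_d) (B : set R),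
      J j /\ measurable B /\
      (S = (fun w => complex.Re (T a (thetaZ j w) X p q)) @^-1` B \/
       S = (fun w => complex.Im (T a (thetaZ j w) X p q)) @^-1` B)].

Definition Fpast (k : int) : set (set Omega) := <<s instrG [set j | j <= k] >>.
Definition Ffut (k : int) : set (set Omega) := <<s instrG [set j | k <= j] >>.

Definition L2sub (B : set (set Omega)) (U : Omega -> R) : Prop :=
  (forall Y : set R, measurable Y -> B (U @^-1` Y)) /\
  (\int[P]_x ((U x) ^+ 2)%:E < +oo)%E.

Definition mean (U : Omega -> R) : R := fine (\int[P]_x (U x)%:E).
Definition cov (U V : Omega -> R) : R :=
  fine (\int[P]_x ((U x - mean U) * (V x - mean V))%:E).
Definition corr (U V : Omega -> R) : R :=
  cov U V / (Num.sqrt (cov U U) * Num.sqrt (cov V V)).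

Definition rho_corr (B D : set (set Omega)) : R :=
  sup [set r | exists U V, L2sub B U /\ L2sub D V /\
                 0 < cov U U /\ 0 < cov V V /\ r = `|corr U V|].

Definition rhoP (n : nat) : R :=
  sup [set r | exists k : nat, r = rho_corr (Fpast k%:Z) (Ffut (k + n)%N%:Z)].

End Mixing.

(* Main.v *)
Require Import Defs.
From HB Require Import structures.
From mathcomp Require Import all_boot all_order all_algebra.
From mathcomp Require Import complex ring lra spectral sesquilinear.
From mathcomp Require Import all_classical all_reals all_analysis measurable_realfun.
Import Order.TTheory GRing.Theory Num.Theory.
Import numFieldNormedType.Exports.
Local Open Scope classical_set_scope.
Local Open Scope ring_scope.
Set Implicit Arguments.
Unset Strict Implicit.
Unset Printing Implicit Defensive.

(** Write the difference of two states as [P - Q] with [P], [Q] positive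
    semidefinite of the same trace [t].  A positive trace-preserving map keeps
    [t]; if moreover it sends every [v v^*] above [eps |v|^2 I], then removing
    [eps t I] from both parts shrinks [t] by the factor [1 - d eps].  A strictly
    positive map admits such an [eps] by compactness, so for some [N] and [eps]
    this holds for [Phi^(N)] on an event of positive probability, to which
    ergodicity makes almost every backward orbit return infinitely often.  Hence
    the pullbacks [Phi^(n)_(theta^-n w)] contract all states to a single one,
    which is [s w].  It dominates a multiple of the identity because some
    pullback is strictly positive, so every initial state is at most [c s w],
    the quenched laws inherit this inequality on cylinders, and a monotone class
    argument extends it to all events.

    For the rate, let [U_c] be the product of the contraction factors over [c]
    consecutive blocks separated by a fixed gap.  Cutting [U_2c] into two halves,
    rho-mixing gives [E U_2c <= (E U_c)^2 + rho E U_c], because the variance of a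
    [0,1]-valued variable is at most its mean.  A large gap makes [rho] small, so
    [E U_c] decays faster than any prescribed power of [c]. *)

(** * Positive semidefinite matrices *)

Section PsdTheory.
Context {C : numClosedFieldType}.

(* Over [R[i]], [adj] and [pos] are convertible to [ctr] and [psd]; a generic
   closed field keeps the canonical structures of [R[i]] out of the algebra. *)
Definition adj m n (M : 'M[C]_(m, n)) : 'M[C]_(n, m) := \matrix_(i, j) (M j i)^*.

Definition qf d (M : 'M[C]_d) (v : 'cV[C]_d) : C := (adj v *m M *m v) 0 0.

Definition pos d (M : 'M[C]_d) : Prop := forall v, 0 <= qf M v.

Definition sqn d (v : 'cV[C]_d) : C := \sum_i `|v i 0| ^+ 2.

Lemma qfE d (M : 'M[C]_d) v :
  qf M v = \sum_i \sum_j (v i 0)^* * M i j * v j 0.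
Proof.
rewrite /qf mxE exchange_big /=; apply: eq_bigr => j _.
by rewrite mxE mulr_suml; apply: eq_bigr => i _; rewrite mxE.
Qed.

Lemma adjK m n (M : 'M[C]_(m, n)) : adj (adj M) = M.
Proof. by apply/matrixP => i j; rewrite !mxE conjCK. Qed.

Lemma adj_mul m n p (M : 'M[C]_(m, n)) (N : 'M[C]_(n, p)) :
  adj (M *m N) = adj N *m adj M.
Proof.
apply/matrixP => i j; rewrite !mxE rmorph_sum; apply: eq_bigr => k _.
by rewrite !mxE rmorphM mulrC.
Qed.

Lemma sqnE d (v : 'cV[C]_d) : sqn v = (adj v *m v) 0 0.
Proof. by rewrite mxE; apply: eq_bigr => i _; rewrite mxE normCKC. Qed.

Lemma sqn_ge0 d (v : 'cV[C]_d) : 0 <= sqn v.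
Proof. by apply: sumr_ge0 => i _; rewrite exprn_ge0. Qed.

Lemma tr_outer d (v : 'cV[C]_d) : \tr (v *m adj v) = sqn v.
Proof.
by apply: eq_bigr => i _; rewrite mxE big_ord1 mxE normCK.
Qed.

Lemma qf_outer d (u v : 'cV[C]_d) :
  qf (u *m adj u) v = `|(adj u *m v) 0 0| ^+ 2.
Proof.
rewrite /qf !mulmxA -mulmxA mxE big_ord1 normCKC; congr (_ * _).
have -> : adj v *m u = adj (adj u *m v) by rewrite adj_mul adjK.
by rewrite mxE.
Qed.

Lemma pos_outer d (u : 'cV[C]_d) : pos (u *m adj u).
Proof. by move=> v; rewrite qf_outer exprn_ge0. Qed.

Lemma qfD d (M N : 'M[C]_d) v : qf (M + N) v = qf M v + qf N v.
Proof. by rewrite /qf mulmxDr mulmxDl mxE. Qed.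

Lemma qfZ d (c : C) (M : 'M[C]_d) v : qf (c *: M) v = c * qf M v.
Proof. by rewrite /qf -scalemxAr -scalemxAl mxE. Qed.

Lemma qfB d (M N : 'M[C]_d) v : qf (M - N) v = qf M v - qf N v.
Proof. by rewrite -scaleN1r qfD qfZ mulN1r. Qed.

Lemma qf_scalar d (c : C) (v : 'cV[C]_d) : qf c%:M v = c * sqn v.
Proof. by rewrite -scalemx1 qfZ /qf mulmx1 sqnE. Qed.

Lemma qf_sum d (I : finType) (F : I -> 'M[C]_d) v :
  qf (\sum_i F i) v = \sum_i qf (F i) v.
Proof.
by rewrite /qf mulmx_sumr mulmx_suml summxE.
Qed.

Lemma posD d (M N : 'M[C]_d) : pos M -> pos N -> pos (M + N).
Proof. by move=> hM hN v; rewrite qfD addr_ge0 ?hM ?hN. Qed.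

Lemma posZ d (c : C) (M : 'M[C]_d) : 0 <= c -> pos M -> pos (c *: M).
Proof. by move=> c0 hM v; rewrite qfZ mulr_ge0 // hM. Qed.

Lemma pos_sum d (I : finType) (F : I -> 'M[C]_d) :
  (forall i, pos (F i)) -> pos (\sum_i F i).
Proof. by move=> h v; rewrite qf_sum sumr_ge0 // => i _; exact: h. Qed.

Lemma pos_scalar d (c : C) : 0 <= c -> pos (c%:M : 'M[C]_d).
Proof. by move=> c0 v; rewrite qf_scalar mulr_ge0 // sqn_ge0. Qed.

Lemma qf_delta d (M : 'M[C]_d) i : qf M (delta_mx i 0) = M i i.
Proof.
rewrite qfE (bigD1 i) //= (bigD1 i) //= !mxE !eqxx conjC1 mul1r mulr1.
rewrite big1 => [|j ji]; last by rewrite !mxE (negbTE ji) mulr0.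
rewrite big1 => [|k ki]; last first.
  by rewrite big1 // => j _; rewrite !mxE (negbTE ki) /= conjC0 !mul0r.
by rewrite !addr0.
Qed.

Lemma pos_diag d (M : 'M[C]_d) i : pos M -> 0 <= M i i.
Proof. by move=> h; rewrite -qf_delta; exact: h. Qed.

Lemma pos_tr d (M : 'M[C]_d) : pos M -> 0 <= \tr M.
Proof. by move=> h; apply: sumr_ge0 => i _; exact: pos_diag. Qed.

Lemma qf_delta2 d (M : 'M[C]_d) i j (c : C) :
  qf M (delta_mx i 0 + c *: delta_mx j 0) =
  M i i + c * M i j + c^* * M j i + c^* * c * M j j.
Proof.
have e k l : (adj (delta_mx k 0 : 'cV[C]_d) *m M *m (delta_mx l 0 : 'cV[C]_d)) 0 0
    = M k l.
  have -> : adj (delta_mx k 0 : 'cV[C]_d) = delta_mx 0 k.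
    by apply/matrixP => x y; rewrite !mxE andbC rmorph_nat.
  by rewrite -rowE -colE !mxE.
rewrite /qf; have -> : adj (delta_mx i 0 + c *: delta_mx j 0 : 'cV[C]_d)
    = adj (delta_mx i 0) + c^* *: adj (delta_mx j 0).
  by apply/matrixP => x y; rewrite !mxE rmorphD rmorphM.
rewrite !mulmxDl !mulmxDr -?scalemxAl -?scalemxAr -?scalemxAl -?scalemxAr .
have aE (X Y : 'M[C]_1) : (X + Y) 0 0 = X 0 0 + Y 0 0 by rewrite mxE.
have zE b (X : 'M[C]_1) : (b *: X) 0 0 = b * X 0 0 by rewrite mxE.
by rewrite !aE !zE !e; ring.
Qed.

(** Polarisation: the form is real at [e_j + c e_i] for every [c], and the choices [c = 1] and
    [c = 'i] together give the conjugate symmetry of the entries. *)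
Lemma pos_adj d (M : 'M[C]_d) : pos M -> adj M = M.
Proof.
move=> h; apply/matrixP => i j; rewrite mxE.
have di k : (M k k)^* = M k k.
  by apply/CrealP; rewrite ger0_real // pos_diag.
have r c : (c * M j i + c^* * M i j)^* = c * M j i + c^* * M i j.
  have /ger0_real/CrealP := h (delta_mx j 0 + c *: delta_mx i 0).
  rewrite qf_delta2 !(rmorphD Num.conj) !(rmorphM Num.conj) /= !conjCK !di => e.
  have {}e : M j j + (c^* * (M j i)^* + c * (M i j)^*) + c * c^* * M i i
    = M j j + (c * M j i + c^* * M i j) + c^* * c * M i i.
    by rewrite !addrA.
  by move: e; rewrite [c^* * c]mulrC => /addIr /addrI.
have := r 1; have := r 'i.
rewrite !(rmorphD Num.conj) !(rmorphM Num.conj) /= !conjCK conjCi conjC1 !mul1r => e1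
  e2.
have e3 : (M j i)^* - (M i j)^* = M i j - M j i.
  apply: (mulfI (neq0Ci C)); apply/eqP; rewrite -subr_eq0; apply/eqP.
  transitivity (('i * M j i + - 'i * M i j) - (- 'i * (M j i)^* + 'i * (M i j)^*)).
    by ring.
  by rewrite e1 subrr.
have e4 : (M j i)^* *+ 2 = M i j *+ 2.
  transitivity (((M j i)^* + (M i j)^*) + ((M j i)^* - (M i j)^*)); first by ring.
  by rewrite e2 e3; ring.
by apply: (pmulrnI (n := 2)).
Qed.

(** Spectral theorem: the vectors are orthonormal eigenvectors scaled by the square roots of the
    eigenvalues, which are values of the form and so nonnegative. *)
Lemma pos_decomp d (M : 'M[C]_d) : pos M ->
  exists w : 'I_d -> 'cV[C]_d, M = \sum_k w k *m adj (w k).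
Proof.
move=> h; have hM := pos_adj h.
have hh : M \is hermsymmx.
  apply/is_hermitianmxP; rewrite expr0 scale1r -[LHS]hM.
  by apply/matrixP => i j; rewrite !mxE.
have /hermitian_normalmx/orthomx_spectralP := hh.
set U := spectralmx M; set D := spectral_diag M.
have uU : U \is unitarymx by exact: spectral_unitarymx.
rewrite (invmx_unitary uU) => eM.
have cU : (U^T ^ Num.conj)%sesqui = adj U by apply/matrixP => i j; rewrite !mxE.
have UK : U *m adj U = 1%:M by move/unitarymxP: uU; rewrite cU.
rewrite cU in eM.
have D0 k : 0 <= D 0 k.
  have := h (adj (row k U)); rewrite /qf adjK -row_mul.
  have -> : row k (U *m M) *m adj (row k U) = (\row_j (U *m M *m adj U) k j *m
    delta_mx k 0).
    apply/matrixP => x y; rewrite !ord1 -colE !mxE; apply: eq_bigr => l _.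
    by rewrite !mxE.
  rewrite -colE mxE [X in 0 <= X]mxE.
  have -> : U *m M *m adj U = diag_mx D.
    by rewrite {1}eM !mulmxA UK mul1mx -mulmxA UK mulmx1.
  by rewrite mxE eqxx mulr1n.
exists (fun k => sqrtC (D 0 k) *: adj (row k U)).
apply/matrixP => i j; rewrite [in LHS]eM summxE mxE; apply: eq_bigr => k _.
rewrite [RHS]mxE big_ord1 !mxE rmorphM /= conjCK.
rewrite (bigD1 k) //= big1 ?addr0 => [|l lk]; last by rewrite !mxE (negbTE lk) mulr0n
  mulr0.
rewrite !mxE eqxx mulr1n.
have /ger0_real/CrealP -> : 0 <= sqrtC (D 0 k) by rewrite sqrtC_ge0.
by rewrite -{1}(sqrtCK (D 0 k)) expr2; ring.
Qed.

(** An entry of a rank-one term has modulus [|w_i| |w_j|], at most the larger of the two squares and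
    so at most the trace of the term. *)
Lemma pos_entry d (M : 'M[C]_d) i j : pos M -> `|M i j| <= \tr M.
Proof.
move=> /pos_decomp [w ->]; rewrite summxE raddf_sum /=.
apply: le_trans (ler_norm_sum _ _ _) _; apply: ler_sum => k _.
rewrite tr_outer mxE big_ord1 mxE normrM norm_conjC.
have a0 := normr_ge0 (w k i 0); have b0 := normr_ge0 (w k j 0).
have le1 l : `|w k l 0| ^+ 2 <= sqn (w k).
  by rewrite /sqn (bigD1 l) //= lerDl sumr_ge0 // => m _; rewrite exprn_ge0.
have [ab|/ltW ba] := real_leP (ger0_real a0) (ger0_real b0).
  by apply: le_trans (le1 j); rewrite expr2 ler_wpM2r.
by apply: le_trans (le1 i); rewrite expr2 ler_wpM2l.
Qed.

(** Entries are at most [\tr M], and [|v_i| |v_j|] is at most the mean of the two squares; summing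
    over all pairs produces the factor [d]. It serves to bound every state by a multiple of the
    identity. *)
Lemma pos_le_tr d (M : 'M[C]_d) : pos M -> pos ((d%:R * \tr M)%:M - M).
Proof.
move=> h v; rewrite qfB qf_scalar.
suff le : `|qf M v| <= d%:R * \tr M * sqn v.
  by rewrite subr_ge0; apply: le_trans le; rewrite ger0_norm ?h.
rewrite qfE; apply: le_trans (ler_norm_sum _ _ _) _.
have -> : d%:R * \tr M * sqn v = \sum_(i < d) \sum_(j < d) \tr M * ((`|v i 0| ^+ 2 +
  `|v j 0| ^+ 2) / 2).
  rewrite (eq_bigr (fun i => \tr M / 2 * (`|v i 0| ^+ 2 *+ d + sqn v))); last first.
    move=> i _; rewrite -mulr_sumr -mulr_suml big_split /= sumr_const card_ord -/(sqn
      v).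
    by rewrite mulrA mulrAC.
  rewrite -mulr_sumr big_split /= sumr_const card_ord sumrMnl -/(sqn v).
  rewrite -(mulr_natl (sqn v)) -mulr2n -(mulr_natl (_ * sqn v)) mulrA divfK
    ?pnatr_eq0 //.
  by rewrite mulrA [d%:R * _]mulrC.
apply: ler_sum => i _; apply: le_trans (ler_norm_sum _ _ _) _; apply: ler_sum => j _.
rewrite !normrM norm_conjC.
have a0 := normr_ge0 (v i 0); have b0 := normr_ge0 (v j 0).
rewrite mulrAC mulrC ler_pM ?mulr_ge0 ?pos_entry //.
rewrite ler_pdivlMr ?ltr0n // -subr_ge0.
have -> : `|v i 0| ^+ 2 + `|v j 0| ^+ 2 - `|v i 0| * `|v j 0| * 2 = (`|v i 0| - `|v j
  0|) ^+ 2 by ring.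
by rewrite real_exprn_even_ge0 // rpredB // ger0_real.
Qed.

End PsdTheory.

(** * Contraction of differences of states *)

Section Contraction.
Context {C : numClosedFieldType} (d : nat).
Implicit Types (f g : 'M[C]_d -> 'M[C]_d) (X Y P Q : 'M[C]_d).

Definition posmap f : Prop := linear f /\ forall M, pos M -> pos (f M).

Lemma linear_fun0 f : linear f -> f 0 = 0.
Proof. by move=> h; have := h (-1) 0 0; rewrite scaler0 addr0 scaleN1r addNr. Qed.

Lemma linear_funD f X Y : linear f -> f (X + Y) = f X + f Y.
Proof. by move=> h; have := h 1 X Y; rewrite !scale1r. Qed.

Lemma linear_funZ f c X : linear f -> f (c *: X) = c *: f X.
Proof. by move=> h; have := h c X 0; rewrite (linear_fun0 h) !addr0. Qed.

Lemma linear_funB f X Y : linear f -> f (X - Y) = f X - f Y.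
Proof. by move=> h; rewrite -scaleN1r linear_funD // linear_funZ // scaleN1r. Qed.

Lemma linear_fun_sum f (I : Type) (r : seq I) (F : I -> 'M[C]_d) : linear f ->
  f (\sum_(i <- r) F i) = \sum_(i <- r) f (F i).
Proof.
move=> h; elim: r => [|i r IH]; first by rewrite !big_nil (linear_fun0 h).
by rewrite !big_cons linear_funD // IH.
Qed.

Lemma posmap_id : posmap id.
Proof. by split. Qed.

Lemma posmap_comp f g : posmap f -> posmap g -> posmap (f \o g).
Proof.
move=> [fl fp] [gl gp]; split => [a u v|M /gp /fp //] /=.
by rewrite gl fl.
Qed.

Lemma posmap_sum (I : finType) (F : I -> 'M[C]_d -> 'M[C]_d) :
  (forall i, posmap (F i)) -> posmap (fun X => \sum_i F i X).
Proof.
move=> h; split => [a u v|M hM].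
  by rewrite scaler_sumr -big_split; apply: eq_bigr => i _; exact: (h i).1.
by apply: pos_sum => i; apply: (h i).2.
Qed.

Definition tpres f : Prop := forall X, \tr (f X) = \tr X.

(** For a hermitian difference of trace zero, the least such [t] is half of its trace norm. *)
Definition close (t : C) X Y : Prop := exists P Q,
  [/\ pos P, pos Q, \tr P = t, \tr Q = t & X - Y = P - Q].

Definition contr (q : C) f : Prop :=
  forall t X Y, close t X Y -> close (q * t) (f X) (f Y).

Definition floor_ge (e : C) f : Prop :=
  forall v w, e * sqn v * sqn w <= qf (f (v *m adj v)) w.

Lemma floor_ge_pos f e M : linear f -> floor_ge e f -> pos M ->
  pos (f M - (e * \tr M)%:M).
Proof.
move=> fl hf /pos_decomp [u ->] v.
rewrite linear_fun_sum // qfB qf_scalar qf_sum subr_ge0 raddf_sum /=.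
rewrite mulrAC mulr_sumr; apply: ler_sum => k _.
by rewrite tr_outer mulrAC; exact: hf.
Qed.

Lemma contr1 f : posmap f -> tpres f -> contr 1 f.
Proof.
move=> [fl fp] ft t X Y [P] [Q] [hP hQ tP tQ e]; exists (f P), (f Q).
by rewrite mul1r !ft -!linear_funB // e; split => //; apply: fp.
Qed.

Lemma contr_floor f e : posmap f -> tpres f -> floor_ge e f ->
  contr (1 - d%:R * e) f.
Proof.
move=> [fl fp] ft ff t X Y [P] [Q] [hP hQ tP tQ eq].
exists (f P - (e * t)%:M), (f Q - (e * t)%:M); split.
- by rewrite -tP; exact: floor_ge_pos.
- by rewrite -tQ; exact: floor_ge_pos.
- by rewrite raddfB /= ft tP mxtrace_scalar -mulr_natl; ring.
- by rewrite raddfB /= ft tQ mxtrace_scalar -mulr_natl; ring.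
- by rewrite -!linear_funB // eq linear_funB // opprB addrA subrK.
Qed.

Lemma contr_comp f g q r : contr q f -> contr r g -> contr (q * r) (f \o g).
Proof. by move=> hf hg t X Y /hg /hf; rewrite mulrA. Qed.

Lemma close_states X Y : pos X -> pos Y -> \tr X = 1 -> \tr Y = 1 -> close 1 X Y.
Proof. by move=> *; exists X, Y. Qed.

Lemma close_entry t X Y i j : close t X Y -> `|X i j - Y i j| <= 2 * t.
Proof.
move=> [P] [Q] [hP hQ tP tQ e].
have -> : X i j - Y i j = P i j - Q i j by move/matrixP/(_ i j): e; rewrite !mxE.
apply: le_trans (ler_normB _ _) _.
by rewrite mulr2n mulrDl mul1r lerD // -?tP -?tQ ?pos_entry // tP -tQ pos_entry.
Qed.

Lemma close_ge0 t X Y : close t X Y -> 0 <= t.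
Proof. by move=> [P] [Q] [hP _ <- _ _]; exact: pos_tr. Qed.

(** Since [P] is hermitian, [P_ii^2] is at most the diagonal entry of [P^2 = X^* X], a sum of [d]
    squares of moduli of entries of [X]. This turns entrywise bounds into a bound on the trace
    norm. *)
Lemma pos_sqrt_tr P X t : 0 <= t -> pos P -> P *m P = adj X *m X ->
  (forall i j, `|X i j| <= t) -> \tr P <= d%:R * d%:R * t.
Proof.
move=> t0 hP e hX; have hA := pos_adj hP.
have sumE (Y : 'M[C]_d) i : (adj Y *m Y) i i = \sum_j `|Y j i| ^+ 2.
  by rewrite mxE; apply: eq_bigr => j _; rewrite mxE normCKC.
have le i : P i i <= d%:R * t.
  have d0 : (0 < d)%N by case: d i => [[]|].
  have := sumE P i; rewrite hA e sumE => e2.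
  have Pi0 := pos_diag i hP.
  rewrite -(@ler_pXn2r _ 2) ?nnegrE ?mulr_ge0 //.
  have : P i i ^+ 2 <= d%:R * t ^+ 2.
    rewrite -{1}(ger0_norm Pi0); apply: le_trans (_ : \sum_j `|P j i| ^+ 2 <= _).
      by rewrite (bigD1 i) //= lerDl sumr_ge0 // => j _; rewrite exprn_ge0.
    rewrite -e2; apply: le_trans (_ : \sum_(j < d) t ^+ 2 <= _).
      by apply: ler_sum => j _; rewrite ler_pXn2r ?nnegrE.
    by rewrite sumr_const card_ord mulr_natl.
  (* Weakening [d] to [d^2] makes the right-hand side the square of [d t]. *)
  move/le_trans; apply; rewrite exprMn ler_wpM2r ?exprn_ge0 //.
  by rewrite -natrX ler_nat leq_pmulr.
apply: le_trans (_ : \sum_(i < d) d%:R * t <= _); first by apply: ler_sum => i _.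
by rewrite sumr_const card_ord -[leLHS]mulr_natl mulrA.
Qed.

End Contraction.

(** * Trace norm and complete positivity over [R[i]] *)

Section Interface.
Context {R : realType}.
Local Notation C := R[i].

Lemma ler_Re (x y : C) : x <= y -> complex.Re x <= complex.Re y.
Proof. by rewrite lecE => /andP[]. Qed.

Lemma tnorm_ge0 d (X : 'M[C]_d) : 0 <= tnorm X.
Proof.
rewrite /tnorm /mabs; case: xgetP => [P _ [hP _]|_]; last by rewrite raddf0.
by have /ler_Re := @pos_tr _ _ P hP.
Qed.

(** The bound holds for whichever positive semidefinite square root [mabs] selects, and trivially
    for its default value [0]. *)
Lemma tnorm_close d t (X Y : 'M[C]_d) : close t%:C%C X Y ->
  tnorm (X - Y) <= 2 * d%:R ^+ 2 * t.
Proof.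
move=> h.
have t0 : 0 <= t by have := close_ge0 h; rewrite lecE => /andP[].
rewrite /tnorm /mabs; case: xgetP => [P _ [hP e]|_]; last first.
  by rewrite raddf0 /= !mulr_ge0 // exprn_ge0.
have : \tr P <= (2 * d%:R ^+ 2 * t)%:C%C.
  have -> : (2 * d%:R ^+ 2 * t)%:C%C = d%:R * d%:R * (2 * t%:C%C).
    by rewrite !rmorphM rmorph_nat /=; ring.
  apply: (@pos_sqrt_tr C d P (X - Y)) => //.
    by rewrite mulr_ge0 // (close_ge0 h).
  by move=> i j; rewrite !mxE; exact: close_entry.
by move/ler_Re.
Qed.

(** This is the case [k = 1]: the form of a one-block matrix is the form of its block. *)
Lemma cp_pos d (f : 'M[C]_d -> 'M[C]_d) : completely_positive f ->
  forall M, pos M -> pos (f M).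
Proof.
move=> cpf M hM.
have blockE (X : 'M[C]_d) (u : 'cV[C]_(\sum_(i < 1) d)) :
    (ctr u *m (\mxblock_(i < 1, j < 1) X) *m u) 0 0 = qf X (submxcol u ord0).
  rewrite -[u]submxcolK.
  have -> : ctr (\mxcol_i submxcol u i) = \mxrow_i ctr (submxcol u i).
    by apply/matrixP => i j; rewrite !mxE; congr (_ ^*).
  rewrite mul_mxrow_mxblock mul_mxrow_mxcol big_ord1 mxcolK.
  by rewrite big_ord1.
have h (v : 'cV[C]_d) : submxcol (\mxcol_(i < 1) v) ord0 = v by rewrite mxcolK.
move=> v; rewrite -(h v) -blockE.
by apply: (cpf 1%N (fun _ _ => M)) => u; rewrite blockE; exact: hM.
Qed.

End Interface.

(** * Polynomial expressions: continuity, measurability, limits *)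

Lemma normc_ge_Im (R : rcfType) (x : R[i]) : `|complex.Im x|%:C%C <= `|x|.
Proof.
case: x => a b; have := normc_ge_Re (Complex b a).
by rewrite !normc_def /= [b ^+ 2 + _]addrC.
Qed.

Section FunctionClass.
Context {R : realType} {X : Type}.
Local Notation C := R[i].

(* The same polynomial expressions are needed to be continuous, measurable with
   respect to two different sigma-algebras, and stable under limits: these four
   properties only use closure under constants, sums and products. *)
Definition fun_alg (K : (X -> R) -> Prop) : Prop :=
  [/\ forall c, K (fun=> c),
      forall f g, K f -> K g -> K (fun x => f x + g x) &
      forall f g, K f -> K g -> K (fun x => f x * g x)].

Variables (K : (X -> R) -> Prop) (hK : fun_alg K).

Definition clC (f : X -> C) : Prop :=
  K (fun x => complex.Re (f x)) /\ K (fun x => complex.Im (f x)).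

Definition clM m n (M : X -> 'M[C]_(m, n)) : Prop :=
  forall i j, clC (fun x => M x i j).

Lemma clC_cst c : clC (fun=> c).
Proof. by have [h _ _] := hK; split; exact: h. Qed.

Lemma fun_algB f g : K f -> K g -> K (fun x => f x - g x).
Proof.
have [kc ka km] := hK => hf hg.
rewrite (_ : (fun x => f x - g x) = (fun x => f x + (-1) * g x)); last first.
  by apply/funext => x; rewrite mulN1r.
by apply: ka => //; apply: km.
Qed.

Lemma clC_add f g : clC f -> clC g -> clC (fun x => f x + g x).
Proof.
have [kc ka km] := hK => -[f1 f2] [g1 g2]; split.
  rewrite (_ : (fun x => _) = (fun x => complex.Re (f x) + complex.Re (g x))).
    exact: ka.
  by apply/funext => x; case: (f x) (g x) => [? ?] [].
rewrite (_ : (fun x => _) = (fun x => complex.Im (f x) + complex.Im (g x))).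
  exact: ka.
by apply/funext => x; case: (f x) (g x) => [? ?] [].
Qed.

Lemma clC_mul f g : clC f -> clC g -> clC (fun x => f x * g x).
Proof.
have [kc ka km] := hK => -[f1 f2] [g1 g2]; split.
  rewrite (_ : (fun x => _) = (fun x => complex.Re (f x) * complex.Re (g x)
     - complex.Im (f x) * complex.Im (g x))); first by apply: fun_algB; exact: km.
  by apply/funext => x; case: (f x) (g x) => [? ?] [].
rewrite (_ : (fun x => _) = (fun x => complex.Re (f x) * complex.Im (g x)
   + complex.Im (f x) * complex.Re (g x))); first by apply: ka; exact: km.
by apply/funext => x; case: (f x) (g x) => [? ?] [].
Qed.

Lemma clC_conj f : clC f -> clC (fun x => (f x)^*).
Proof.
have [kc ka km] := hK => -[f1 f2]; split.
  by rewrite (_ : (fun x => _) = (fun x => complex.Re (f x))) //; apply/funext => x;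
    case: (f x).
rewrite (_ : (fun x => _) = (fun x => 0 - complex.Im (f x))); first exact: fun_algB.
by apply/funext => x; case: (f x) => a b; rewrite sub0r.
Qed.

Lemma clC_sum (I : Type) (r : seq I) (F : I -> X -> C) :
  (forall i, clC (F i)) -> clC (fun x => \sum_(i <- r) F i x).
Proof.
move=> h; elim: r => [|i r IH].
  rewrite (_ : (fun x => _) = (fun=> 0)); first exact: clC_cst.
  by apply/funext => x; rewrite big_nil.
rewrite (_ : (fun x => _) = (fun x => F i x + \sum_(j <- r) F j x)).
  exact: clC_add.
by apply/funext => x; rewrite big_cons.
Qed.

Lemma clC_sqn d (v : X -> 'cV[C]_d) : clM v -> clC (fun x => sqn (v x)).
Proof.
move=> h; apply: clC_sum => i.
rewrite (_ : (fun x => _) = (fun x => v x i 0 * (v x i 0)^*)).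
  by apply: clC_mul; [exact: h|apply: clC_conj; exact: h].
by apply/funext => x; rewrite normCK.
Qed.

Lemma clC_qf d (M : X -> 'M[C]_d) (v : X -> 'cV[C]_d) :
  clM M -> clM v -> clC (fun x => qf (M x) (v x)).
Proof.
move=> hM hv.
rewrite (_ : (fun x => _) =
  (fun x => \sum_i \sum_j (v x i 0)^* * M x i j * v x j 0)).
  apply: clC_sum => i; apply: clC_sum => j; apply: clC_mul; last exact: hv.
  by apply: clC_mul; [apply: clC_conj; exact: hv|exact: hM].
by apply/funext => x; rewrite qfE.
Qed.

Lemma clM_outer d (v : X -> 'cV[C]_d) : clM v -> clM (fun x => v x *m adj (v x)).
Proof.
move=> h i j; rewrite (_ : (fun x => _) = (fun x => v x i 0 * (v x j 0)^*)).
  by apply: clC_mul; [exact: h|apply: clC_conj; exact: h].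
by apply/funext => x; rewrite mxE big_ord1 mxE.
Qed.

(** Expanding [M x] in matrix units reduces the varying argument of [F x] to constant ones. *)
Lemma clM_app d (F : X -> 'M[C]_d -> 'M[C]_d) (M : X -> 'M[C]_d) :
  (forall x, linear (F x)) -> (forall Y, clM (fun x => F x Y)) -> clM M ->
  clM (fun x => F x (M x)).
Proof.
move=> lF hF hM i j.
rewrite (_ : (fun x => _) = (fun x =>
  \sum_p \sum_q M x p q * F x (delta_mx p q) i j)).
  apply: clC_sum => p; apply: clC_sum => q.
  by apply: clC_mul; [exact: hM|exact: hF].
apply/funext => x; rewrite [in LHS](matrix_sum_delta (M x)) linear_fun_sum // summxE.
apply: eq_bigr => p _; rewrite linear_fun_sum // summxE.
by apply: eq_bigr => q _; rewrite linear_funZ // mxE.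
Qed.

(** A pair of complex vectors is coded by one real row vector, indexed by the choice of vector, real
    or imaginary part, and coordinate. Compactness and density of rational points can then be used
    in a real space. *)
Definition rvec d (b : bool) (y : 'rV[R]_#|{: bool * bool * 'I_d}|) : 'cV[C]_d :=
  \col_i Complex (y 0 (enum_rank (b, false, i))) (y 0 (enum_rank (b, true, i))).

(** The slack in [floor_ge e f] at the coded pair; for linear [f] it is a polynomial in the
    coordinates of [y]. *)
Definition gap d (f : 'M[C]_d -> 'M[C]_d) (e : R)
    (y : 'rV[R]_#|{: bool * bool * 'I_d}|) : C :=
  qf (f (rvec true y *m adj (rvec true y))) (rvec false y)
  - e%:C%C * sqn (rvec true y) * sqn (rvec false y).

Lemma clC_gap d (F : X -> 'M[C]_d -> 'M[C]_d) e
    (y : X -> 'rV[R]_#|{: bool * bool * 'I_d}|) :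
  (forall x, linear (F x)) -> (forall Y, clM (fun x => F x Y)) ->
  (forall k, K (fun x => y x 0 k)) -> clC (fun x => gap (F x) e (y x)).
Proof.
move=> lF hF hy.
have hv b : clM (fun x => rvec b (y x)).
  move=> i j; split.
    by rewrite (_ : (fun x => _) = (fun x => y x 0 (enum_rank (b, false, i)))) //;
       apply/funext => x; rewrite mxE.
  by rewrite (_ : (fun x => _) = (fun x => y x 0 (enum_rank (b, true, i)))) //;
     apply/funext => x; rewrite mxE.
rewrite /gap (_ : (fun x => _) = (fun x =>
  qf (F x (rvec true (y x) *m adj (rvec true (y x)))) (rvec false (y x))
  + (- e%:C%C) * (sqn (rvec true (y x)) * sqn (rvec false (y x))))); last first.
  by apply/funext => x; rewrite mulNr mulrA.
apply: clC_add.
  by apply: clC_qf => //; apply: clM_app => //; exact: clM_outer.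
by apply: clC_mul; [exact: clC_cst|apply: clC_mul; exact: clC_sqn].
Qed.

End FunctionClass.

Section ClassInstances.
Context {R : realType}.

Lemma fun_alg_continuous (T : topologicalType) :
  fun_alg (fun f : T -> R => continuous f).
Proof.
split => [c x|f g hf hg x|f g hf hg x]; first exact: cst_continuous.
  by apply: cvgD; [exact: hf|exact: hg].
by apply: cvgM; [exact: hf|exact: hg].
Qed.

Lemma fun_alg_measurable d (T : measurableType d) :
  fun_alg (fun f : T -> R => measurable_fun setT f).
Proof.
split => [c|f g hf hg|f g hf hg]; first exact: measurable_cst.
  exact: measurable_funD.
exact: measurable_funM.
Qed.

(** [None] is the point at infinity: it carries the limit, and [Some n] the terms. In this form
    convergence becomes an instance of [fun_alg]. *)
Definition converges (u : option nat -> R) : Prop :=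
  (fun n => u (Some n)) @ \oo --> u None.

Lemma fun_alg_converges : fun_alg converges.
Proof.
split => [c|f g hf hg|f g hf hg]; first exact: cvg_cst.
  exact: cvgD.
exact: cvgM.
Qed.

End ClassInstances.

(** * Uniform lower bounds for strictly positive maps *)

Section Floor.
Context {R : realType} (d : nat).
Local Notation C := R[i].
Local Notation V := 'rV[R]_#|{: bool * bool * 'I_d}|.

Lemma pos_real (M : 'M[C]_d) v : pos M -> qf M v = (complex.Re (qf M v))%:C%C.
Proof.
by move=> h; have := h v; rewrite lecE => /andP[/eqP /= e _]; case: (qf M v) e => a b
  /= ->.
Qed.

Lemma sqn_real n (v : 'cV[C]_n) : sqn v = (complex.Re (sqn v))%:C%C.
Proof.
by have := sqn_ge0 v; rewrite lecE => /andP[/eqP /= e _]; case: (sqn v) e => a b /= ->.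
Qed.

Lemma gap_real f e (y : V) : posmap f -> gap f e y = (complex.Re (gap f e y))%:C%C.
Proof.
move=> [_ fp]; rewrite /gap (pos_real _ (fp _ (@pos_outer _ _ _))).
by rewrite (sqn_real (rvec true y)) (sqn_real (rvec false y)) -!rmorphM -rmorphB.
Qed.

Definition vpair (v w : 'cV[C]_d) : V := \row_k
  let: (b, c, i) := enum_val k in
  let z := (if b then v else w) i 0 in if c then complex.Im z else complex.Re z.

Lemma rvec_vpair v w b : rvec b (vpair v w) = if b then v else w.
Proof.
apply/matrixP => i j; rewrite ord1 !mxE !enum_rankK /=.
by case: b; case: (_ i 0).
Qed.

Lemma floor_gap f e : posmap f ->
  floor_ge e%:C%C f <-> forall y : V, 0 <= complex.Re (gap f e y).
Proof.
move=> hf; split => [h y|h v w].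
  have : 0 <= gap f e y by rewrite subr_ge0; exact: h.
  by rewrite gap_real // ler0c.
have := h (vpair v w); rewrite -ler0c -gap_real // /gap !rvec_vpair /=.
by rewrite subr_ge0.
Qed.

(** Every [y] is a limit of rational points and the slack passes to the limit. Only countably many
    conditions remain, which gives measurability when [f] depends on a random parameter. *)
Lemma floor_gap_rat f e : posmap f ->
  floor_ge e%:C%C f <->
  forall q : 'rV[rat]_#|{: bool * bool * 'I_d}|, 0 <= complex.Re (gap f e (map_mx
    (ratr : rat -> R) q)).
Proof.
move=> hf; rewrite floor_gap //; split => [h q|h y]; first exact: h.
have ex n : exists q : 'rV[rat]_#|{: bool * bool * 'I_d}|,
    forall k, `|y 0 k - (ratr (q 0 k) : R)| < n.+1%:R^-1.
  have /all_sig [q hq] k : {q : rat | `|y 0 k - ratr q| < n.+1%:R^-1}.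
    apply: cid; have n0 : 0 < n.+1%:R^-1 :> R by rewrite invr_gt0.
    have [|q] := @rat_in_itvoo R (y 0 k - n.+1%:R^-1) (y 0 k + n.+1%:R^-1).
      by rewrite ltrD2l; apply: lt_trans n0; rewrite oppr_lt0.
    rewrite in_itv /= => /andP[q1 q2]; exists q.
    by rewrite distrC ltr_distl q1 q2.
  by exists (\row_k q k) => k; rewrite mxE.
have [q hq] := choice ex.
pose u o := if o is Some n then map_mx (ratr : rat -> R) (q n) : V else y.
have hF Y : clM converges (fun _ : option nat => f Y).
  by move=> i j; apply: clC_cst; exact: fun_alg_converges.
have hu k : converges (fun o => u o 0 k).
  apply/cvgrPdist_lt => eps eps0; near=> n.
  rewrite mxE; apply: lt_le_trans (hq n k) _.
  by apply: ltW; near: n; exact: (near_infty_natSinv_lt (PosNum eps0)).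
have [cu _] := clC_gap fun_alg_converges e (fun=> hf.1) hF hu.
have := cu; rewrite /converges /= => cv.
by apply: (cvgr_to_ge cv); near=> n; exact: h.
Unshelve. all: by end_near.
Qed.

(** The slack at [e = 0] attains its minimum on the product of two unit spheres, and the minimum is
    positive by strict positivity. Homogeneity of degree two in each vector carries it to all
    pairs. *)
Lemma strictly_positive_floor (f : 'M[C]_d -> 'M[C]_d) : (0 < d)%N -> posmap f ->
  strictly_positive f ->
  exists2 e, 0 < e & floor_ge e%:C%C f.
Proof.
move=> d0 hf sf.
pose S := [set y : V | sqn (rvec true y) = 1 /\ sqn (rvec false y) = 1].
have idK k : continuous (fun y : V => y 0 k) by exact: coord_continuous.
have rcl b : clM (fun g : V -> R => continuous g) (fun y : V => rvec b y).
  move=> i j; split.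
    by rewrite (_ : (fun x => _) = (fun x : V => x 0 (enum_rank (b, false, i)))) //;
       apply/funext => x; rewrite mxE.
  by rewrite (_ : (fun x => _) = (fun x : V => x 0 (enum_rank (b, true, i)))) //;
     apply/funext => x; rewrite mxE.
have Sb b (y : V) c i : S y -> `|y 0 (enum_rank (b, c, i))| <= 1.
  move=> hy.
  have : `|rvec b y i 0| ^+ 2 <= 1.
    have e : sqn (rvec b y) = 1.
      by case: hy => h1 h2; case: b; [exact: h1|exact: h2].
    by rewrite -[X in _ <= X]e /sqn (bigD1 i) //= lerDl sumr_ge0 // => j _; rewrite exprn_ge0.
  rewrite -[X in _ <= X](expr1n _ 2) ler_pXn2r ?nnegrE // mxE => h1.
  rewrite -lecR; apply: le_trans h1; case: c.
    exact: (normc_ge_Im (Complex _ _)).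
  exact: (normc_ge_Re (Complex _ _)).
have cS : compact S.
  apply: bounded_closed_compact.
    exists 1; split => // M M1 y Sy.
    rewrite /= /Num.norm /= mx_normrE; apply/bigmax_leP; split => [|[i k] _ /=].
      by apply: le_trans (ltW M1).
    rewrite ord1 -(enum_valK k); case: (enum_val k) => -[b c] j.
    by apply: le_trans (ltW M1); exact: Sb.
  rewrite (_ : S = (fun y => complex.Re (sqn (rvec true y))) @^-1` [set 1] `&`
                  (fun y => complex.Re (sqn (rvec false y))) @^-1` [set 1]); last first.
    apply/seteqP; split => y /= [h1 h2]; first by rewrite h1 h2.
    by rewrite /S /= sqn_real h1 [X in _ /\ X = _]sqn_real h2.
  apply: closedI; apply: closed_comp; try exact: closed_eq.
    by move=> y _; apply: (clC_sqn (fun_alg_continuous _) (rcl true)).1.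
  by move=> y _; apply: (clC_sqn (fun_alg_continuous _) (rcl false)).1.
have S0 : S !=set0.
  exists (vpair (delta_mx (Ordinal d0) 0) (delta_mx (Ordinal d0) 0)).
  rewrite /S /= !rvec_vpair /=.
  suff -> : sqn (delta_mx (Ordinal d0) 0 : 'cV[C]_d) = 1 by [].
  rewrite /sqn (bigD1 (Ordinal d0)) //= mxE !eqxx normr1 expr1n big1 ?addr0 // => i
    /negbTE hi.
  by rewrite mxE hi normr0 expr0n.
have cg : {within S, continuous (fun y => complex.Re (gap f 0 y))}.
  apply: continuous_subspaceT.
  have hF Y : clM (fun g : V -> R => continuous g) (fun _ : V => f Y).
    by move=> i j; apply: clC_cst; exact: fun_alg_continuous.
  exact: (clC_gap (fun_alg_continuous _) 0 (fun=> hf.1) hF idK).1.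
have [y yS ymin] := compact_EVT_min S0 cS cg.
have nz (v : 'cV[C]_d) : (sqn v == 0) = (v == 0).
  apply/idP/eqP => [|->]; last first.
    by rewrite /sqn big1 // => i _; rewrite mxE normr0 expr0n.
  rewrite psumr_eq0 => [/allP h|i _]; last by rewrite exprn_ge0.
  apply/matrixP => i j; rewrite ord1 mxE; apply/eqP.
  by have := h i (mem_index_enum _); rewrite /= expf_eq0 normr_eq0.
have gapE z : gap f 0 z = qf (f (rvec true z *m adj (rvec true z))) (rvec false z).
  by rewrite /gap !mul0r subr0.
exists (complex.Re (gap f 0 y)).
  rewrite -ltcR -gap_real // gapE; move: yS; rewrite inE => -[y1 y2].
  apply: (sf _ _ _); rewrite -?nz ?y2 ?oner_eq0 //; first exact: pos_outer.
  by apply: contraTneq (oner_neq0 C) => h; rewrite -y1 -tr_outer h mxtrace0 eqxx.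
(* A zero vector cannot be normalised; for it the bound reduces to positivity of [f]. *)
move=> v w.
have [->|v0] := eqVneq v 0.
  rewrite (eqP (_ : sqn 0 == 0)) ?nz // mulr0 mul0r.
  by apply: hf.2; exact: pos_outer.
have [->|w0] := eqVneq w 0.
  rewrite (eqP (_ : sqn 0 == 0)) ?nz // mulr0.
  by apply: hf.2; exact: pos_outer.
have s_gt0 (u : 'cV[C]_d) : u != 0 -> 0 < sqrtC (sqn u).
  by move=> u0; rewrite sqrtC_gt0 lt_neqAle eq_sym nz u0 sqn_ge0.
pose nv (u : 'cV[C]_d) := (sqrtC (sqn u))^-1 *: u.
have sqnZ c (u : 'cV[C]_d) : sqn (c *: u) = `|c| ^+ 2 * sqn u.
  by rewrite /sqn mulr_sumr; apply: eq_bigr => i _; rewrite mxE normrM exprMn.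
have nv1 u : u != 0 -> sqn (nv u) = 1.
  move=> u0; rewrite sqnZ normfV (gtr0_norm (s_gt0 _ u0)) exprVn sqrtCK mulVf //.
  by rewrite nz.
have nvE u : u != 0 -> u = sqrtC (sqn u) *: nv u.
  by move=> u0; rewrite scalerA mulfV ?scale1r // gt_eqF // s_gt0.
have inS : vpair (nv v) (nv w) \in S by rewrite inE /S /= !rvec_vpair !nv1.
have hm : gap f 0 y <= qf (f (nv v *m adj (nv v))) (nv w).
  have hm := ymin _ inS.
  have e1 := gap_real 0 y hf.
  have e2 := gap_real 0 (vpair (nv v) (nv w)) hf.
  move: (gapE (vpair (nv v) (nv w))); rewrite !rvec_vpair => <-.
  by rewrite e1 e2 lecR.
have adjZ c (u : 'cV[C]_d) : adj (c *: u) = c^* *: adj u.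
  by apply/matrixP => i j; rewrite !mxE rmorphM.
have outerZ c (u : 'cV[C]_d) : (c *: u) *m adj (c *: u) = `|c| ^+ 2 *: (u *m adj u).
  by rewrite adjZ -scalemxAl -scalemxAr scalerA normCK.
have qfvZ c (M : 'M[C]_d) u : qf M (c *: u) = `|c| ^+ 2 * qf M u.
  have sE b (A : 'M[C]_1) : (b *: A) 0 0 = b * A 0 0 by rewrite mxE.
  by rewrite /qf adjZ -!scalemxAl -scalemxAr !sE mulrA normCKC.
have <- := gap_real 0 y hf; rewrite [in X in _ <= X](nvE v v0) [in X in _ <= X](nvE w
  w0) outerZ (linear_funZ _ _ hf.1) qfZ qfvZ.
rewrite (gtr0_norm (s_gt0 _ v0)) (gtr0_norm (s_gt0 _ w0)) !sqrtCK.
rewrite [_ * sqn v]mulrC -mulrA [gap _ _ _ * _]mulrC ler_wpM2l ?sqn_ge0 //.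
by rewrite ler_wpM2l ?sqn_ge0.
Qed.

End Floor.

Section FloorMeasurable.
Context {R : realType} (d : nat) (disp : measure_display) (X : measurableType disp).
Local Notation C := R[i].

Lemma measurable_floor (F : X -> 'M[C]_d -> 'M[C]_d) e :
  (forall x, posmap (F x)) ->
  (forall Y, clM (fun g : X -> R => measurable_fun setT g) (fun x => F x Y)) ->
  measurable [set x | floor_ge e%:C%C (F x)].
Proof.
move=> pF hF.
pose B (q : 'rV[rat]_#|{: bool * bool * 'I_d}|) : set X :=
  [set x | 0 <= complex.Re (gap (F x) e (map_mx (ratr : rat -> R) q))].
(* The rational vectors are enumerated through [unpickle]; numbers that code no vector contribute
   the full set. *)
rewrite (_ : [set x | _] = \bigcap_n oapp B setT (unpickle n)); last first.
  apply/seteqP; split => x /=.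
    move/(floor_gap_rat _ (pF x)) => h n _; case: unpickle => //= q; exact: h.
  move=> h; apply/(floor_gap_rat _ (pF x)) => q.
  by have := h (pickle q) I; rewrite pickleK.
apply: bigcap_measurableType => n _; case: unpickle => [q|] //=.
rewrite (_ : B q = (fun x => complex.Re (gap (F x) e (map_mx (ratr : rat -> R) q)))
  @^-1` `[0, +oo[); last by apply/seteqP; split => x /=; rewrite in_itv /= andbT.
rewrite -[_ @^-1` _]setTI.
have hq k : measurable_fun setT (fun _ : X => (map_mx (ratr : rat -> R) q) 0 k).
  exact: measurable_cst.
by have [m _] := clC_gap (fun_alg_measurable _) e (fun x => (pF x).1) hF hq; exact: m.
Qed.

End FloorMeasurable.

(** * The cocycle of quantum channels *)

Section Cocycle.
Context {R : realType} {dO : measure_display} {Omega : measurableType dO}.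
Local Notation C := R[i].
Variables (d : nat) (A : finType) (theta : Omega -> Omega)
  (T : A -> Omega -> 'M[C]_d -> 'M[C]_d).
Hypothesis hT : forall a w, posmap (T a w).

Lemma posmap_PhiK k w : posmap (PhiK theta T k w).
Proof. by apply: posmap_sum => a; exact: hT. Qed.

Lemma posmap_Phin n w : posmap (Phin theta T n w).
Proof.
elim: n => [|n IH]; first exact: posmap_id.
exact: (posmap_comp (posmap_PhiK n.+1 w) IH).
Qed.

Lemma posmap_Tseq s n w : posmap (Tseq theta T s n w).
Proof.
elim: n => [|n IH]; first exact: posmap_id.
exact: (posmap_comp (hT (s n) (iter n.+1 theta w)) IH).
Qed.

Lemma PhinD m n w X :
  Phin theta T (m + n) w X = Phin theta T n (iter m theta w) (Phin theta T m w X).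
Proof.
elim: n => [|n IH]; first by rewrite addn0.
by rewrite addnS /= IH /PhiK; apply: eq_bigr => a _; rewrite -addnS addnC iterD.
Qed.

Lemma tpres_Phin n w :
  (forall j, tpres (fun X => \sum_a T a (iter j theta w) X)) ->
  tpres (Phin theta T n w).
Proof. by move=> h; elim: n => [|n IH] X //=; rewrite /PhiK (h n.+1) IH. Qed.

(** The hypothesis involves the times [1] to [n] only, so that [K] may be measurability with respect
    to a sigma-algebra generated by a window of times. *)
Lemma clM_Phin (X : Type) (K : (X -> R) -> Prop) (h : X -> Omega) n :
  fun_alg K ->
  (forall i a Y, (1 <= i <= n)%N -> clM K (fun x => T a (iter i theta (h x)) Y)) ->
  forall Y, clM K (fun x => Phin theta T n (h x) Y).
Proof.
move=> hK; elim: n => [|n IH] hcl Y; first by move=> i j; exact: clC_cst.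
apply: (clM_app hK (F := fun x => PhiK theta T n.+1 (h x))
  (M := fun x => Phin theta T n (h x) Y)) => [x|Z|].
- exact: (posmap_PhiK _ _).1.
- move=> i j; rewrite /PhiK.
  rewrite (_ : (fun x => _) = (fun x => \sum_a T a (iter n.+1 theta (h x)) Z i j)).
    by apply: (clC_sum hK) => a; apply: hcl; rewrite ltnS leqnn.
  by apply/funext => x; rewrite summxE.
- by apply: IH => i a Z /andP[i1 i2]; apply: hcl; rewrite i1 leqW.
Qed.

End Cocycle.

(** * Recurrence *)

Section Recurrence.
Context {R : realType} {dO : measure_display} {Omega : measurableType dO}.
Variables (P : probability Omega R) (g : Omega -> Omega).
Hypothesis mg : measurable_fun setT g.
Hypothesis pg : forall E, measurable E -> P (g @^-1` E) = P E.

Lemma measurable_iter n : measurable_fun setT (iter n g).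
Proof.
elim: n => [|n IH]; first exact: measurable_id.
exact: (measurableT_comp mg IH).
Qed.

Lemma measurable_iter_preimage n E : measurable E -> measurable (iter n g @^-1` E).
Proof. by move=> mE; rewrite -[_ @^-1` _]setTI; exact: (measurable_iter n). Qed.

Lemma iter_preserving n E : measurable E -> P (iter n g @^-1` E) = P E.
Proof.
move=> mE; elim: n => //= n <-.
rewrite -(pg (measurable_iter_preimage n mE)); congr (P _).
by apply/seteqP; split => w /=; rewrite -iterS iterSr.
Qed.

Lemma ae_iter n (Q : Omega -> Prop) :
  {ae P, forall w, Q w} -> {ae P, forall w, Q (iter n g w)}.
Proof.
move=> [N [mN N0 QN]]; exists (iter n g @^-1` N); split.
- exact: measurable_iter_preimage.
- by rewrite iter_preserving.
- by move=> w h; apply: QN.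
Qed.

Lemma ae_orbit (Q : Omega -> Prop) :
  {ae P, forall w, Q w} -> {ae P, forall w, forall n, Q (iter n g w)}.
Proof. by move=> h; apply: ae_foralln => n; exact: ae_iter. Qed.

Hypothesis erg : forall E, measurable E -> g @^-1` E = E -> P E = 0%E \/ P E = 1%E.

(** The set of points whose orbit meets [E] infinitely often is invariant. It is a decreasing limit
    of sets of probability at least [P E], so ergodicity leaves only probability one. *)
Lemma ae_recurrent E : measurable E -> P E != 0%E ->
  {ae P, forall w, forall n, exists2 m, (n <= m)%N & E (iter m g w)}.
Proof.
move=> mE E0.
pose B n := \bigcup_(m in [set m | (n <= m)%N]) (iter m g @^-1` E).
have mB n : measurable (B n).
  by apply: bigcup_measurable => m _; exact: measurable_iter_preimage.
pose F := \bigcap_n B n.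
have mF : measurable F by apply: bigcap_measurableType => n _.
have FP w : F w <-> forall n, exists2 m, (n <= m)%N & E (iter m g w).
  by split => [h n|h n _]; [have [m] := h n I; exists m|have [m] := h n; exists m].
have invF : g @^-1` F = F.
  apply/seteqP; split => w /=; rewrite !FP => h n.
    by have [m nm Em] := h n; exists m.+1; [exact: leqW|rewrite iterSr].
  (* Asking for a visit at time at least [n.+1] excludes time [0], so the visit has a predecessor in
     time. *)
  by have [[|m] // nm Em] := h n.+1; exists m => //; rewrite -iterSr.
have leB n : (P E <= P (B n))%E.
  rewrite -(iter_preserving n mE); apply: le_measure; rewrite ?inE //.
    exact: measurable_iter_preimage.
  by move=> w Ew; exists n => /=.
have cB : P \o B @ \oo --> P F.
  apply: nonincreasing_cvg_mu => //.
    by apply: le_lt_trans (probability_le1 _ _) _ => //; exact: ltry.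
  move=> n m nm; apply/subsetPset => w [k /= mk Ek]; exists k => //=.
  exact: leq_trans mk.
have leF : (P E <= P F)%E.
  rewrite -(cvg_lim _ cB) //; apply: lime_ge; first by apply/cvg_ex; exists (P F).
  by apply: nearW => n; exact: leB.
have PF1 : P F = 1%E.
  have [F0|//] := erg mF invF; exfalso; move: leF; rewrite F0 => h.
  by move/eqP: E0; apply; apply/eqP; rewrite eq_le h measure_ge0.
exists (~` F); split; first exact: measurableC.
  by rewrite probability_setC // PF1 subee.
by move=> w /= h /FP.
Qed.

End Recurrence.

(** * The stationary state *)

Section MatrixLimits.
Context {R : realType} (d : nat).
Local Notation C := R[i].
Implicit Types (S : nat -> 'M[C]_d) (L : 'M[C]_d).

Definition cvgM S L : Prop :=
  clM converges (fun o => if o is Some n then S n else L).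

Lemma cvgM_intro S L :
  (forall eps : R, 0 < eps -> exists n0, forall n, (n0 <= n)%N ->
     forall i j, `|S n i j - L i j| <= eps%:C%C) -> cvgM S L.
Proof.
move=> h i j; split; apply/cvgrPdist_le => eps e0; have [n0 hn] := h _ e0;
  exists n0 => // n /= n0n; rewrite distrC -lecR; apply: le_trans (hn n n0n i j).
  by have := normc_ge_Re (S n i j - L i j); case: (S n i j) (L i j) => [? ?] [].
by have := normc_ge_Im (S n i j - L i j); case: (S n i j) (L i j) => [? ?] [].
Qed.

Lemma cvgM_unique S L L' : cvgM S L -> cvgM S L' -> L = L'.
Proof.
move=> h h'; apply/matrixP => i j; have [r1 i1] := h i j; have [r2 i2] := h' i j.
move: r1 i1 r2 i2; rewrite /converges /=.
case: (L i j) (L' i j) => [a b] [a' b'] /= r1 i1 r2 i2.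
by rewrite (cvg_unique _ r1 r2) // (cvg_unique _ i1 i2).
Qed.

Lemma cvgM_shift k S L : cvgM S L -> cvgM (fun n => S (n + k)%N) L.
Proof.
by move=> h i j; have [h1 h2] := h i j; split;
  [move: h1|move: h2]; rewrite /converges /= => h0; rewrite (cvg_shiftn k (fun n => _
    (S n i j))).
Qed.

Lemma cvgM_map f S L : linear f -> cvgM S L -> cvgM (fun n => f (S n)) (f L).
Proof.
move=> lf h.
have := @clM_app R _ _ fun_alg_converges d (fun=> f) _ (fun=> lf) _ h.
move=> H i j.
have {}H : clM converges (fun o => f (if o is Some n then S n else L)).
  by apply: H => Y k l; apply: clC_cst; exact: fun_alg_converges.
by have := H i j; rewrite (_ : (fun o => _) = (fun o => (if o is Some n then f (S n)
  else f L) i j)) //; apply/funext => -[].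
Qed.

Lemma cvgM_pos S L : (forall n, pos (S n)) -> cvgM S L -> pos L.
Proof.
move=> hS h v.
have [h1 h2] : clC converges (fun o => qf (if o is Some n then S n else L) v).
  by apply: (clC_qf fun_alg_converges) => // i j; apply: clC_cst; exact:
    fun_alg_converges.
rewrite lecE; apply/andP; split.
  rewrite (cvg_unique _ h2 (_ : _ --> 0)) //.
  rewrite (_ : (fun n => _) = (fun=> 0)); first exact: cvg_cst.
  by apply/funext => n; have := hS n v; rewrite lecE => /andP[/eqP].
by apply: (cvgr_to_ge h1); apply: nearW => n; have /ler_Re := hS n v.
Qed.

Lemma cvgM_tr S L c : (forall n, \tr (S n) = c) -> cvgM S L -> \tr L = c.
Proof.
move=> hS h.
have [h1 h2] : clC converges (fun o => \tr (if o is Some n then S n else L)).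
  by apply: (clC_sum fun_alg_converges) => i; exact: h.
have cst (a : R) (u : nat -> R) : (forall n, u n = a) -> u @ \oo --> a.
  by move=> ua; rewrite (_ : u = (fun=> a)); [exact: cvg_cst|apply/funext].
move: h1 h2; rewrite /converges /= => h1 h2.
have e1 := cvg_unique _ h1 (cst (complex.Re c) _ (fun n => congr1 _ (hS n))).
have e2 := cvg_unique _ h2 (cst (complex.Im c) _ (fun n => congr1 _ (hS n))).
by case: (\tr L) e1 e2 => a b; case: c {hS} => a' b' /= -> // ->.
Qed.

Lemma cauchyM_cvg S :
  (forall eps : R, 0 < eps -> exists n0, forall n, (n0 <= n)%N ->
     forall i j, `|S n i j - S n0 i j| <= eps%:C%C) ->
  cvgM S (\matrix_(i, j) Complex (limn (fun n => complex.Re (S n i j)))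
                                 (limn (fun n => complex.Im (S n i j)))).
Proof.
move=> h i j; rewrite /clC /converges.
have cau (u : nat -> R) : (forall eps : R, 0 < eps -> exists n0, forall n,
    (n0 <= n)%N -> `|u n - u n0| <= eps) -> u @ \oo --> limn u.
  move=> hu; apply/cauchy_cvgP/cauchy_exP => eps e0.
  have [n0 hn] := hu (eps / 2) (divr_gt0 e0 (ltr0n _ 2)).
  exists (u n0), n0 => // n n0n; rewrite /ball /= distrC.
  by apply: le_lt_trans (hn n n0n) _; rewrite gtr_pMr // invf_lt1 ?ltr1n.
split.
  under eq_fun do rewrite /=; rewrite /= mxE /=.
  apply: cau => eps e0; have [n0 hn] := h _ e0; exists n0 => n n0n.
  rewrite -lecR; apply: le_trans (hn n n0n i j).
  by have := normc_ge_Re (S n i j - S n0 i j); case: (S n i j) (S n0 i j) => [? ?] [].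
rewrite /= mxE /=.
apply: cau => eps e0; have [n0 hn] := h _ e0; exists n0 => n n0n.
rewrite -lecR; apply: le_trans (hn n n0n i j).
by have := normc_ge_Im (S n i j - S n0 i j); case: (S n i j) (S n0 i j) => [? ?] [].
Qed.

End MatrixLimits.

(** * Events on which the cocycle is bounded below *)

Section FloorEvents.
Context {R : realType} {dO : measure_display} {Omega : measurableType dO}.
Local Notation C := R[i].
Variables (d : nat) (A : finType) (theta : Omega -> Omega)
  (T : A -> Omega -> 'M[C]_d -> 'M[C]_d).
Hypothesis hT : forall a w, posmap (T a w).
Hypothesis theta_meas : measurable_fun setT theta.
Hypothesis T_meas : forall a X, mx_measurable (fun w => T a w X).

Definition floor_event n k : set Omega :=
  [set w | floor_ge (k.+1%:R^-1)%:C%C (Phin theta T n w)].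

(** The first condition drives the contraction. The second, with a level depending on [n], serves to
    bound the stationary state below: there the whole stretch from a past visit to the present must
    have a floor. *)
Definition floor_event_tail N k : set Omega :=
  floor_event N k `&` \bigcap_(n in [set n | (N <= n)%N]) \bigcup_j floor_event n j.

Lemma clM_Phin_measurable n (g : Omega -> Omega) Y : measurable_fun setT g ->
  clM (fun f : Omega -> R => measurable_fun setT f) (fun w => Phin theta T n (g w) Y).
Proof.
move=> mg; apply: (clM_Phin hT) => [|i a Z _ p q]; first exact: fun_alg_measurable.
have mi : measurable_fun setT (fun w => iter i theta (g w)).
  exact: (measurableT_comp (measurable_iter theta_meas i) mg).
by have [h1 h2] := T_meas a Z p q; split;
  [exact: (measurableT_comp h1 mi)|exact: (measurableT_comp h2 mi)].
Qed.

Lemma measurable_floor_event n k : measurable (floor_event n k).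
Proof.
apply: measurable_floor => [w|Y]; first exact: posmap_Phin.
exact: (clM_Phin_measurable n Y (@measurable_id _ _ _)).
Qed.

Lemma measurable_floor_event_tail N k : measurable (floor_event_tail N k).
Proof.
apply: measurableI; first exact: measurable_floor_event.
apply: bigcap_measurableType => n _; apply: bigcupT_measurable => j.
exact: measurable_floor_event.
Qed.

Lemma strictly_positive_floor_event n w : (0 < d)%N ->
  strictly_positive (Phin theta T n w) -> exists k, floor_event n k w.
Proof.
move=> d0 /(strictly_positive_floor d0 (posmap_Phin theta hT n w)) [e e0 he].
have [k _ hk] := near_infty_natSinv_lt (PosNum e0).
exists k => u v; apply: le_trans (he u v).
by rewrite !ler_wpM2r ?sqn_ge0 // lecR; apply: ltW; exact: (hk k (leqnn k)).
Qed.

(** By strict positivity these countably many events cover almost every point, so they cannot all be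
    null. *)
Lemma floor_event_tail_gt0 (P : probability Omega R) : (0 < d)%N ->
  {ae P, forall w, exists N0 : nat, forall n : nat, (N0 <= n)%N ->
    strictly_positive (Phin theta T n w)} ->
  exists N k, P (floor_event_tail N k) != 0%E.
Proof.
move=> d0 esp; apply: contrapT => h.
have h0 N k : P (floor_event_tail N k) = 0%E.
  by apply: contrapT => hh; apply: h; exists N, k; apply/eqP.
have hneg : P.-negligible (\bigcup_N \bigcup_k floor_event_tail N k).
  apply: negligible_bigcup => N; apply: negligible_bigcup => k.
  by exists (floor_event_tail N k); split; [exact: measurable_floor_event_tail|exact:
    h0|].
have [Z [mZ Z0 hZ]] := negligibleU hneg esp.
have : P setT = 0%E.
  apply/eqP; rewrite eq_le measure_ge0 andbT -Z0; apply: le_measure; rewrite ?inE //.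
  move=> w _; apply: hZ; apply: contrapT => /not_orP[h1 h2]; apply: h1.
  move/contrapT: h2 => [N hN].
  have [k hk] := strictly_positive_floor_event d0 (hN N (leqnn N)).
  exists N => //; exists k => //; split => // n Nn.
  by have [j hj] := strictly_positive_floor_event d0 (hN n Nn); exists j.
by rewrite probability_setT => /eqP; rewrite onee_eq0.
Qed.

End FloorEvents.

(** * Pullbacks from the remote past and their limit *)

Section Stationary.
Context {R : realType} {dO : measure_display} {Omega : measurableType dO}.
Local Notation C := R[i].
Variables (P : probability Omega R) (d : nat) (A : finType)
  (theta thetainv : Omega -> Omega) (T : A -> Omega -> 'M[C]_d -> 'M[C]_d).
Hypothesis d_gt0 : (0 < d)%N.
Hypothesis theta_meas : measurable_fun setT theta.
Hypothesis thetainv_meas : measurable_fun setT thetainv.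
Hypothesis theta_inv1 : cancel theta thetainv.
Hypothesis theta_inv2 : cancel thetainv theta.
Hypothesis theta_pres : forall E, measurable E -> P (theta @^-1` E) = P E.
Hypothesis theta_ergodic : forall E, measurable E -> theta @^-1` E = E ->
  P E = 0%E \/ P E = 1%E.
Hypothesis hT : forall a w, posmap (T a w).
Hypothesis T_meas : forall a X, mx_measurable (fun w => T a w X).
Hypothesis Phi_tp : {ae P, forall w, trace_preserving (fun X => \sum_(a : A) T a w X)}.
Hypothesis ESP : {ae P, forall w, exists N0 : nat, forall n : nat, (N0 <= n)%N ->
  strictly_positive (Phin theta T n w)}.

Lemma thetainv_pres E : measurable E -> P (thetainv @^-1` E) = P E.
Proof.
move=> mE; rewrite -theta_pres; last by rewrite -[_ @^-1` _]setTI; exact: thetainv_meas.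
by congr (P _); apply/seteqP; split => w /=; rewrite theta_inv1.
Qed.

Lemma thetainv_ergodic E : measurable E -> thetainv @^-1` E = E ->
  P E = 0%E \/ P E = 1%E.
Proof.
move=> mE h; apply: theta_ergodic => //; rewrite -[in LHS]h.
by apply/seteqP; split => w /=; rewrite theta_inv1.
Qed.

Lemma iter_thetaK m n w :
  iter m theta (iter (m + n) thetainv w) = iter n thetainv w.
Proof.
by elim: m => // m IH; rewrite addSn iterSr /= theta_inv2.
Qed.

Lemma iter_thetainvK n w : iter n thetainv (iter n theta w) = w.
Proof. by elim: n => // n IH; rewrite iterSr /= theta_inv1. Qed.

(** Evolution from time [-n] to time [0]. Lengthening it adds maps on the inside, so a contraction
    already gained near time [0] persists. *)
Definition pullback n w : 'M[C]_d -> 'M[C]_d :=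
  Phin theta T n (iter n thetainv w).

Lemma pullbackD m n w X :
  pullback (m + n) w X = pullback n w (pullback m (iter n thetainv w) X).
Proof.
by rewrite /pullback PhinD iter_thetaK -iterD.
Qed.

Definition tp_orbit w : Prop :=
  forall m j, tpres (fun X => \sum_a T a (iter j theta (iter m thetainv w)) X).

Lemma tpres_pullback n m w : tp_orbit w -> tpres (pullback n (iter m thetainv w)).
Proof.
move=> h; apply: tpres_Phin => j X.
by rewrite -iterD; exact: h.
Qed.

Lemma tpres_pullback0 n w : tp_orbit w -> tpres (pullback n w).
Proof. by move=> h; exact: (tpres_pullback n 0 h). Qed.

Lemma ae_tp_orbit : {ae P, forall w, tp_orbit w}.
Proof.
have h := ae_orbit theta_meas theta_pres Phi_tp.
have {}h := ae_orbit thetainv_meas thetainv_pres h.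
by apply: filterS h => w hw m j; exact: hw.
Qed.

Lemma posmap_pullback n w : posmap (pullback n w).
Proof. exact: posmap_Phin. Qed.

Definition visits N k w : Prop :=
  forall n, exists2 m, (n <= m)%N & floor_event_tail theta T N k (iter m thetainv w).

(** Each further visit in the past contributes one more factor; all stretches between visits
    contract with constant [1]. *)
Lemma contr_pullback N k w : tp_orbit w -> visits N k w ->
  forall J, exists n0, forall n, (n0 <= n)%N ->
    contr ((1 - d%:R * (k.+1%:R^-1)%:C%C) ^+ J) (pullback n w).
Proof.
move=> tp hv; elim=> [|J [n0 IH]].
  exists 0%N => n _; rewrite expr0; apply: contr1; first exact: posmap_pullback.
  exact: tpres_pullback0.
(* A visit at time [-m] with [m >= n0 + N] has its block of [N] steps finished at least [n0] steps
   before time [0], where the induction hypothesis applies. *)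
have [m hm [Em _]] := hv (n0 + N)%N; exists m => n mn.
have Nm : (N <= m)%N by apply: leq_trans hm; exact: leq_addl.
rewrite (_ : pullback n w = pullback (m - N) w \o
  (pullback N (iter (m - N) thetainv w) \o pullback (n - m) (iter m thetainv w))).
  rewrite exprSr; apply: contr_comp.
    by apply: IH; rewrite leq_subRL // addnC.
  rewrite -[X in contr X]mulr1; apply: contr_comp.
    apply: contr_floor; [exact: posmap_pullback|exact: tpres_pullback|].
    by rewrite /pullback -iterD subnKC.
  by apply: contr1; [exact: posmap_pullback|exact: tpres_pullback].
apply/funext => X /=.
rewrite -[in LHS](subnK mn) pullbackD -[in LHS](subnKC Nm) pullbackD.
by rewrite subnKC.
Qed.

(** The maximally mixed state, used as a fixed starting point for all pullbacks. *)
Definition rho0 : 'M[C]_d := (d%:R^-1)%:M.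

Lemma rho0_pos : pos rho0.
Proof. by apply: pos_scalar; rewrite invr_ge0. Qed.

Lemma rho0_tr : \tr rho0 = 1.
Proof. by rewrite mxtrace_scalar -[_ *+ d]mulr_natr mulVf // pnatr_eq0 -lt0n. Qed.

Lemma pullback_close N k w : tp_orbit w -> visits N k w ->
  forall eps : R, 0 < eps -> exists n0, forall n, (n0 <= n)%N -> forall X Y,
  is_state X -> is_state Y ->
  forall i j, `|pullback n w X i j - pullback n w Y i j| <= eps%:C%C.
Proof.
move=> tp hv eps e0.
pose q : R := 1 - d%:R * k.+1%:R^-1.
have qE : 1 - d%:R * (k.+1%:R^-1)%:C%C = q%:C%C by rewrite rmorphB rmorphM rmorph1
  rmorph_nat.
have q1 : q < 1 by rewrite gtrBl mulr_gt0 ?ltr0n // invr_gt0 ltr0n.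
(* A pair of states is sent to a pair that is [close] with parameter [q], and such a parameter is
   the trace of a positive semidefinite matrix. *)
have q0 : 0 <= q.
  have [n0 h] := contr_pullback tp hv 1; have := h n0 (leqnn _); rewrite expr1 qE => hc.
  have /hc/close_ge0 := close_states rho0_pos rho0_pos rho0_tr rho0_tr.
  by rewrite mulr1 ler0c.
have [J qJ] : exists J, 2 * q ^+ J <= eps.
  have /cvgr0Pnorm_le cq : q ^+ n @[n --> \oo] --> 0.
    by apply: cvg_expr; rewrite ger0_norm.
  have [|J _ hJ] := cq (eps / 2); first by rewrite divr_gt0.
  exists J; rewrite mulrC -ler_pdivlMr //; apply: le_trans (ler_norm _) _.
  exact: (hJ J (leqnn J)).
have [n0 h] := contr_pullback tp hv J; exists n0 => n n0n X Y [pX tX] [pY tY] i j.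
have := h n n0n _ _ _ (close_states pX pY tX tY).
move/close_entry => /(_ i j) /le_trans; apply.
by rewrite mulr1 qE -rmorphXn -(rmorph_nat (real_complex R) 2) -rmorphM lecR.
Qed.

Lemma pullback_state n w X : tp_orbit w -> is_state X -> is_state (pullback n w X).
Proof.
move=> tp [pX tX]; split; first exact: (posmap_pullback n w).2.
by rewrite tpres_pullback0.
Qed.

Lemma pullback_shift_state n m w X : tp_orbit w -> is_state X ->
  is_state (pullback n (iter m thetainv w) X).
Proof.
move=> tp [pX tX]; split; first exact: (posmap_pullback n _).2.
by rewrite tpres_pullback.
Qed.

Lemma rho0_state : is_state rho0.
Proof. by split; [exact: rho0_pos|exact: rho0_tr]. Qed.

Definition slim w : 'M[C]_d :=
  \matrix_(i, j) Complex (limn (fun n => complex.Re (pullback n w rho0 i j)))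
                         (limn (fun n => complex.Im (pullback n w rho0 i j))).

(** A longer pullback of [rho0] is the pullback of length [n0] of some other state, so closeness of
    pullbacks yields the Cauchy property. *)
Lemma slim_cvg N k w : tp_orbit w -> visits N k w ->
  cvgM (fun n => pullback n w rho0) (slim w).
Proof.
move=> tp hv; apply: (@cauchyM_cvg _ _ (fun n => pullback n w rho0)) => eps e0.
have [n0 h] := pullback_close tp hv e0; exists n0 => n n0n i j.
rewrite -{1}(subnK n0n) pullbackD; apply: h => //.
  by apply: pullback_shift_state => //; exact: rho0_state.
exact: rho0_state.
Qed.

Lemma pullback_measurable n : clM (fun f : Omega -> R => measurable_fun setT f)
  (fun w => pullback n w rho0).
Proof.
apply: (clM_Phin_measurable hT theta_meas T_meas).
exact: measurable_iter.
Qed.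

Lemma dyn_stationary_exists : exists s : Omega -> 'M[C]_d,
  dyn_stationary theta T P s /\
  (forall s', dyn_stationary theta T P s' -> {ae P, forall w, s' w = s w}).
Proof.
have [N [k E0]] := floor_event_tail_gt0 hT theta_meas T_meas d_gt0 ESP.
have mE := measurable_floor_event_tail hT theta_meas T_meas N k.
have aev : {ae P, forall w, visits N k w}.
  exact: (ae_recurrent thetainv_meas thetainv_pres thetainv_ergodic mE E0).
have aeg : {ae P, forall w, tp_orbit w /\ visits N k w}.
  by apply: filterS2 ae_tp_orbit aev => w; split.
have [Z [mZ Z0 hZ]] := aeg.
have goodP w : w \notin Z -> tp_orbit w /\ visits N k w.
  by rewrite notin_setE => wZ; apply: contrapT => h; apply: wZ; exact: hZ.
have aeZ : {ae P, forall w, w \notin Z}.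
  exists Z; split => // w /=; rewrite notin_setE => h; exact: contrapT.
(* On the exceptional null set both the sequence and its limit are [rho0]. Convergence then holds at
   every point, so [s] is measurable and a state everywhere, as [random_state] demands. *)
pose S n w := if w \in Z then rho0 else pullback n w rho0.
pose s w := if w \in Z then rho0 else slim w.
have Scvg w : cvgM (S ^~ w) (s w).
  rewrite /S /s; case: ifPn => [_|/goodP [tp hv]]; last exact: (slim_cvg tp hv).
  by move=> i j; split; rewrite /converges /=; exact: cvg_cst.
have Sstate n w : is_state (S n w).
  rewrite /S; case: ifPn => [_|/goodP [tp hv]]; first exact: rho0_state.
  by apply: pullback_state => //; exact: rho0_state.
have Smeas n i j : measurable_fun setT (fun w => complex.Re (S n w i j)) /\
                   measurable_fun setT (fun w => complex.Im (S n w i j)).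
  have [m1 m2] := pullback_measurable n i j.
  have mS : measurable_fun setT (fun w => w \in Z).
    by apply: (measurable_fun_bool true); rewrite setTI (_ : _ @^-1` _ = Z) //;
       apply/seteqP; split => w /= hw; [exact: set_mem|exact: mem_set].
  split.
    rewrite (_ : (fun w => _) = (fun w => if w \in Z then complex.Re (rho0 i j)
      else complex.Re (pullback n w rho0 i j))).
      by apply: measurable_fun_ifT.
    by apply/funext => w; rewrite /S; case: ifP.
  rewrite (_ : (fun w => _) = (fun w => if w \in Z then complex.Im (rho0 i j)
    else complex.Im (pullback n w rho0 i j))).
    by apply: measurable_fun_ifT.
  by apply/funext => w; rewrite /S; case: ifP.
exists s; split; last first.
  move=> s' [[_ st'] inv'].
  (* Uniqueness: invariance along the backward orbit writes [s' w] as a pullback of a state for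
     every length, and pullbacks forget their starting state. *)
  have h := ae_orbit thetainv_meas thetainv_pres inv'.
  apply: filterS2 aeZ h => w wZ hinv.
  have [tp hv] := goodP _ wZ.
  apply: (@cvgM_unique R d (S ^~ w)); last exact: Scvg.
  apply: cvgM_intro => eps e0; have [n0 hn0] := pullback_close tp hv e0.
  exists n0 => n n0n i j.
  have -> : s' w = pullback n w (s' (iter n thetainv w)).
    rewrite /pullback hinv; congr s'.
    by rewrite -{2}[n]addn0 iter_thetaK.
  rewrite /S (negbTE wZ); apply: hn0 => //; exact: rho0_state.
split; first split.
- move=> i j; split.
    apply: (measurable_fun_cvg (h := fun n w => complex.Re (S n w i j))) => [n|w _].
      exact: (Smeas n i j).1.
    exact: (Scvg w i j).1.
  apply: (measurable_fun_cvg (h := fun n w => complex.Im (S n w i j))) => [n|w _].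
    exact: (Smeas n i j).2.
  exact: (Scvg w i j).2.
- move=> w; split.
    by apply: (cvgM_pos _ (Scvg w)) => n; exact: (Sstate n w).1.
  by apply: (cvgM_tr _ (Scvg w)) => n; exact: (Sstate n w).2.
- apply: filterS2 aeZ (ae_orbit theta_meas theta_pres aeZ) => w wZ woZ n.
  (* Evolving the pullback of length [m] at [w] by [n] steps gives the pullback of length [m + n] at
     [theta^n w]; both sides of the invariance are limits of this one sequence. *)
  have c1 : cvgM (fun m => Phin theta T n w (S m w)) (Phin theta T n w (s w)).
    by apply: cvgM_map (Scvg w); exact: (posmap_Phin theta hT n w).1.
  apply: (cvgM_unique c1).
  have := cvgM_shift n (Scvg (iter n theta w)).
  rewrite (_ : (fun m => S (m + n)%N (iter n theta w)) =
     (fun m => Phin theta T n w (S m w))) //.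
  apply/funext => m; rewrite /S (negbTE (woZ n)) (negbTE wZ) pullbackD.
  by rewrite {1}/pullback !iter_thetainvK.
Qed.

Lemma dyn_stationary_pd s : dyn_stationary theta T P s ->
  {ae P, forall w, exists2 e : R, 0 < e & pos (s w - e%:C%C%:M)}.
Proof.
move=> [[_ st] inv].
have [N [k E0]] := floor_event_tail_gt0 hT theta_meas T_meas d_gt0 ESP.
have mE := measurable_floor_event_tail hT theta_meas T_meas N k.
have aev : {ae P, forall w, visits N k w}.
  exact: (ae_recurrent thetainv_meas thetainv_pres thetainv_ergodic mE E0).
apply: filterS2 aev (ae_orbit thetainv_meas thetainv_pres inv) => w hv hinv.
(* A visit at time [-m] with [m >= N] gives a floor for the whole evolution of length [m], which
   maps [s (theta^-m w)] to [s w]. *)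
have [m Nm [_ /(_ m Nm) [j _ hj]]] := hv N.
exists (j.+1%:R^-1); first by rewrite invr_gt0.
have [p t] := st (iter m thetainv w).
have := floor_ge_pos (posmap_Phin theta hT m (iter m thetainv w)).1 hj p.
by have := iter_thetaK m 0 w; rewrite addn0 t mulr1 hinv => ->.
Qed.

End Stationary.

(** * Absolute continuity of the quenched laws *)

Section Cylinders.
Context {R : realType} (A : finType) (a0 : A).
Implicit Types (B : set (seqMeas a0)) (Q : probability (seqMeas a0) R).

(** These events are the finite disjoint unions of cylinders of a common length; they form a ring
    that generates the product sigma-algebra. *)
Definition finite_horizon B : Prop := exists n, forall x y : seqMeas a0,
  (forall i, (i < n)%N -> x i = y i) -> B x -> B y.

(** Words are padded with [a0] because [cyl] is indexed by a full sequence. *)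
Definition extend n (w : {ffun 'I_n -> A}) : nat -> A :=
  fun i => oapp w a0 (insub i).

Lemma extendE n (w : {ffun 'I_n -> A}) (i : 'I_n) : extend w i = w i.
Proof. by rewrite /extend valK. Qed.

Lemma measurable_cyl w n : measurable (cyl a0 w n).
Proof.
rewrite (_ : cyl a0 w n = \bigcap_(i in [set i | (i < n)%N])
  ((fun x : seqsp a0 => x i) @^-1` [set w i])).
  apply: bigcap_measurableType => i _.
  by apply: sub_sigma_algebra; exists i, [set w i].
by apply/seteqP; split => x /= h i; exact: h.
Qed.

Lemma finite_horizon_cyl B : finite_horizon B -> exists n,
  B = \bigcup_(w in [set w : {ffun 'I_n -> A} | B (extend w)]) cyl a0 (extend w) n.
Proof.
move=> [n h]; exists n; apply/seteqP; split => x.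
  move=> Bx; pose w := [ffun i : 'I_n => x i].
  have xw i : (i < n)%N -> x i = extend w i.
    by move=> ni; rewrite (extendE w (Ordinal ni)) ffunE.
  by exists w => //=; apply: h Bx => i /xw.
move=> [w /= Bw xw]; apply: h Bw => i ni; exact/esym/xw.
Qed.

Lemma trivIset_cyl n (D : set {ffun 'I_n -> A}) :
  trivIset D (fun w => cyl a0 (extend w) n).
Proof.
move=> w w' _ _ [x [h h']]; apply/ffunP => i.
by rewrite -!extendE -h // -h'.
Qed.

Lemma measurable_finite_horizon B : finite_horizon B -> measurable B.
Proof.
move=> /finite_horizon_cyl [n ->]; apply: fin_bigcup_measurable => [|w _].
  exact: finite_finset.
exact: measurable_cyl.
Qed.

Lemma finite_horizon_le Q1 Q2 (c : \bar R) : (0 <= c)%E ->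
  (forall s n, (Q1 (cyl a0 s n) <= c * Q2 (cyl a0 s n))%E) ->
  forall B, finite_horizon B -> (Q1 B <= c * Q2 B)%E.
Proof.
move=> c0 h B /finite_horizon_cyl [n ->].
have fD : finite_set [set w : {ffun 'I_n -> A} | B (extend w)] by exact: finite_finset.
rewrite !measure_fin_bigcup //; try by [exact: trivIset_cyl|move=> w _; exact:
  measurable_cyl].
by rewrite ge0_mule_fsumr //; apply: lee_fsum => // w _; exact: h.
Qed.

Lemma finite_horizon_setring : setring finite_horizon.
Proof.
split.
- by exists 0%N.
- move=> X Y [n hX] [m hY]; exists (maxn n m) => x y e [Xx|Yx].
    by left; apply: hX Xx => i ni; apply: e; rewrite leq_max ni.
  by right; apply: hY Yx => i ni; apply: e; rewrite leq_max ni orbT.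
- move=> X Y [n hX] [m hY]; exists (maxn n m) => x y e [Xx Yx]; split.
    by apply: hX Xx => i ni; apply: e; rewrite leq_max ni.
  by move=> Yy; apply: Yx; apply: hY Yy => i ni; apply/esym/e; rewrite leq_max ni orbT.
Qed.

Lemma measurable_le_of_cyl Q1 Q2 (c : R) : 0 <= c ->
  (forall s n, (Q1 (cyl a0 s n) <= c%:E * Q2 (cyl a0 s n))%E) ->
  forall B, measurable B -> (Q1 B <= c%:E * Q2 B)%E.
Proof.
move=> c0 h.
(* Continuity of finite measures from below and from above makes [H] a monotone class; it contains
   the ring of finite-horizon events by finite additivity. *)
pose H := [set B : set (seqMeas a0) | measurable B /\ (Q1 B <= c%:E * Q2 B)%E].
have monH : monotone H.
  split=> F mF hF.
    have mU : measurable (\bigcup_i F i) by apply: bigcupT_measurable => i; exact: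
      (hF i).1.
    split => //.
    have c1 := nondecreasing_cvg_mu (mu := Q1) (fun i => (hF i).1) mU mF.
    have c2 := nondecreasing_cvg_mu (mu := Q2) (fun i => (hF i).1) mU mF.
    have c3 : (fun n => c%:E * Q2 (F n))%E @ \oo --> (c%:E * Q2 (\bigcup_i F i))%E.
      by apply: cvgeZl => //.
    by apply: (lee_cvg_to c1 c3); apply: nearW => n; exact: (hF n).2.
  have mU : measurable (\bigcap_i F i) by apply: bigcapT_measurable => i; exact: (hF
    i).1.
  split => //.
  have fin (Q : probability (seqMeas a0) R) : (Q (F 0%N) < +oo)%E.
    by apply: le_lt_trans (probability_le1 _ (hF 0%N).1) _; exact: ltry.
  have c1 := nonincreasing_cvg_mu (mu := Q1) (fin Q1) (fun i => (hF i).1) mU mF.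
  have c2 := nonincreasing_cvg_mu (mu := Q2) (fin Q2) (fun i => (hF i).1) mU mF.
  have c3 : (fun n => c%:E * Q2 (F n))%E @ \oo --> (c%:E * Q2 (\bigcap_i F i))%E.
    by apply: cvgeZl => //.
  by apply: (lee_cvg_to c1 c3); apply: nearW => n; exact: (hF n).2.
have subH : finite_horizon `<=` H.
  move=> B hB; split; first exact: measurable_finite_horizon.
  exact: finite_horizon_le.
have := monotone_setring_sub_g_sigma_ring monH finite_horizon_setring subH.
move=> sub B mB; suff : H B by case.
apply: sub.
have : coordG a0 `<=` <<sr @finite_horizon >>.
  move=> S [n [V ->]]; apply: sub_gen_smallest; exists n.+1 => x y e /=.
  by rewrite e.
(* The full space has horizon [0], so the generated sigma-ring is closed under complements. *)
have sa : sigma_algebra setT <<sr @finite_horizon >>.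
  have [r0 rD rU] := smallest_sigma_ring (@finite_horizon).
  split => // X hX; apply: rD => //; apply: sub_gen_smallest; by exists 0%N.
by move=> hG; apply: (smallest_sub sa hG).
Qed.

End Cylinders.

Section QuenchedAC.
Context {R : realType} {dO : measure_display} {Omega : measurableType dO}.
Local Notation C := R[i].
Variables (d : nat) (A : finType) (a0 : A) (theta : Omega -> Omega)
  (T : A -> Omega -> 'M[C]_d -> 'M[C]_d).
Hypothesis hT : forall a w, posmap (T a w).

Lemma quenched_law_dominates w (rho sigma : 'M[C]_d) (e : R)
    (Q1 Q2 : probability (seqMeas a0) R) :
  0 < e -> is_state rho -> pos (sigma - e%:C%C%:M) ->
  is_quenched_law theta T a0 rho w Q1 ->
  is_quenched_law theta T a0 sigma w Q2 -> Q1 `<< Q2.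
Proof.
move=> e0 [prho trho] psig h1 h2.
(* [sigma] is at least [e I] and a state is at most [d I], whence [rho <= (d / e) sigma]. *)
pose c : R := d%:R / e.
have c0 : 0 <= c by rewrite divr_ge0 // ltW.
have pc : pos (c%:C%C *: sigma - rho).
  have -> : c%:C%C *: sigma - rho =
      c%:C%C *: (sigma - e%:C%C%:M) + ((d%:R * \tr rho)%:M - rho).
    rewrite trho mulr1 scalerBr addrA; congr (_ - _).
    by rewrite scale_scalar_mx -rmorphM /c divfK ?gt_eqF // rmorph_nat subrK.
  by apply: posD; [apply: posZ => //; rewrite ler0c|exact: pos_le_tr].
have hcyl s n : (Q1 (cyl a0 s n) <= c%:E * Q2 (cyl a0 s n))%E.
  have [fl fp] := posmap_Tseq theta hT s n w.
  have := pos_tr (fp _ pc); rewrite linear_funB // linear_funZ // raddfB /=.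
  rewrite mxtraceZ h1 h2 subr_ge0 => /ler_Re /=.
  rewrite mul0r subr0 => le.
  have f1 : Q1 (cyl a0 s n) \is a fin_num by apply: fin_num_measure; exact:
    measurable_cyl.
  have f2 : Q2 (cyl a0 s n) \is a fin_num by apply: fin_num_measure; exact:
    measurable_cyl.
  by rewrite -(fineK f1) -(fineK f2) -EFinM lee_fin.
apply/null_content_dominatesP => B mB B0.
apply/eqP; rewrite eq_le measure_ge0 andbT.
by have := measurable_le_of_cyl c0 hcyl mB; rewrite B0 mule0.
Qed.

End QuenchedAC.

(** * Correlation bounds *)

Section Correlation.
Context {R : realType} {dO : measure_display} {Omega : measurableType dO}.
Variable P : probability Omega R.
Implicit Types (U V : Omega -> R) (B D : set (set Omega)).

Lemma covE U V : cov P U V = fine (covariance P U V).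
Proof. by rewrite /cov covariance.unlock expectation.unlock. Qed.

Lemma P_fin : P setT \is a fin_num.
Proof. by rewrite probability_setT. Qed.

Lemma Lfun2_of_sqr U : measurable_fun setT U ->
  (\int[P]_x ((U x) ^+ 2)%:E < +oo)%E -> U \in Lfun P 2%:E.
Proof.
move=> mU fU; rewrite inE; apply/andP; split; first by rewrite inE.
rewrite inE /= /finite_norm Lnorm.unlock /=.
apply: poweR_lty; apply: le_lt_trans fU; rewrite le_eqVlt; apply/orP; left.
apply/eqP; apply: eq_integral => x _ /=.
by rewrite powR_mulrn // real_normK // num_real.
Qed.

Lemma L2sub_Lfun B U : B `<=` measurable -> L2sub P B U -> U \in Lfun P 2%:E.
Proof.
move=> sB [mU fU]; apply: Lfun2_of_sqr fU => _ Y mY.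
by rewrite setTI; apply: sB; exact: mU.
Qed.

Lemma cov_fin U V : U \in Lfun P 2%:E -> V \in Lfun P 2%:E ->
  covariance P U V \is a fin_num.
Proof.
move=> hU hV; apply: covariance_fin_num; try exact: (Lfun_subset12 P_fin).
exact: Lfun2_mul_Lfun1.
Qed.

Lemma cov_ge0 U : 0 <= cov P U U.
Proof. by rewrite covE fine_ge0 // variance_ge0. Qed.

Lemma abs_cov_le U V : U \in Lfun P 2%:E -> V \in Lfun P 2%:E ->
  `|cov P U V| <= Num.sqrt (cov P U U) * Num.sqrt (cov P V V).
Proof.
have one X Y : X \in Lfun P 2%:E -> Y \in Lfun P 2%:E ->
    cov P X Y <= Num.sqrt (cov P X X) * Num.sqrt (cov P Y Y).
  move=> hX hY; have := covariance_le hX hY.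
  rewrite -(fineK (cov_fin hX hY)) -(fineK (variance_fin_num hX)) -(fineK
    (variance_fin_num hY)).
  by rewrite /= lee_fin !covE.
(* The one-sided Cauchy-Schwarz bound is applied to [-U] as well to reach the absolute value. *)
move=> hU hV; rewrite ler_norml one // andbT lerNl.
have hN : (\- U) \in Lfun P 2%:E by rewrite rpredN.
have L1 := Lfun_subset12 P_fin.
have e1 : covariance P (\- U) V = (- covariance P U V)%E.
  by apply: covarianceNl; [exact: L1|exact: L1|exact: Lfun2_mul_Lfun1].
have e2 : covariance P (\- U) (\- U) = covariance P U U := varianceN hU.
by have := one _ _ hN hV; rewrite !covE e1 e2 fineN.
Qed.

Lemma corr_le1 U V : U \in Lfun P 2%:E -> V \in Lfun P 2%:E ->
  0 < cov P U U -> 0 < cov P V V -> `|corr P U V| <= 1.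
Proof.
move=> hU hV U0 V0; rewrite /corr normrM normfV.
have s0 : 0 < Num.sqrt (cov P U U) * Num.sqrt (cov P V V) by
  apply: mulr_gt0; rewrite sqrtr_gt0.
by rewrite (gtr0_norm s0) ler_pdivrMr // mul1r abs_cov_le.
Qed.

(** [sup] dominates the members of a set only when the set is bounded above, which Cauchy-Schwarz
    ensures here. *)
Lemma corr_ubound B D : B `<=` measurable -> D `<=` measurable ->
  ubound [set r | exists U V, L2sub P B U /\ L2sub P D V /\
                 0 < cov P U U /\ 0 < cov P V V /\ r = `|corr P U V|] 1.
Proof.
move=> sB sD r [U [V [hU [hV [U0 [V0 ->]]]]]].
by apply: corr_le1 => //; [exact: (L2sub_Lfun sB)|exact: (L2sub_Lfun sD)].
Qed.

Lemma rho_corr_le1 B D : B `<=` measurable -> D `<=` measurable ->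
  rho_corr P B D <= 1.
Proof.
move=> sB sD; rewrite /rho_corr; set E := [set r | _].
have [->|/set0P E0] := eqVneq E set0; first by rewrite sup0.
exact: ge_sup E0 (corr_ubound sB sD).
Qed.

Lemma abs_cov_rho B D U V (rho : R) : B `<=` measurable -> D `<=` measurable ->
  L2sub P B U -> L2sub P D V -> 0 <= rho -> rho_corr P B D <= rho ->
  `|cov P U V| <= rho * (Num.sqrt (cov P U U) * Num.sqrt (cov P V V)).
Proof.
move=> sB sD hU hV rho0 hrho.
have lU := L2sub_Lfun sB hU; have lV := L2sub_Lfun sD hV.
(* The supremum ranges over variables of positive variance; if a variance vanishes, so does the
   covariance. *)
have := cov_ge0 U; rewrite le_eqVlt => /predU1P[U0|U0].
  by apply: le_trans (abs_cov_le lU lV) _; rewrite -U0 sqrtr0 !mul0r mulr0.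
have := cov_ge0 V; rewrite le_eqVlt => /predU1P[V0|V0].
  by apply: le_trans (abs_cov_le lU lV) _; rewrite -V0 sqrtr0 !mulr0.
have s0 : 0 < Num.sqrt (cov P U U) * Num.sqrt (cov P V V) by
  apply: mulr_gt0; rewrite sqrtr_gt0.
rewrite -ler_pdivrMr // -[X in _ / X](gtr0_norm s0) -normfV -normrM.
apply: le_trans hrho; apply: ub_le_sup; last by exists U, V.
by exists 1; exact: corr_ubound.
Qed.

Definition unit_valued U : Prop := forall x, 0 <= U x <= 1.

Lemma unit_Lfun2 U : measurable_fun setT U -> unit_valued U -> U \in Lfun P 2%:E.
Proof.
move=> mU hU; apply: Lfun2_of_sqr => //.
apply: (@le_lt_trans _ _ (\int[P]_x (cst 1%E x))%E).
  apply: ge0_le_integral => //.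
  - by move=> x _; rewrite lee_fin exprn_ge0 //; case/andP: (hU x).
  - by apply/measurable_EFinP; exact: measurable_funX.
  - by move=> x _; rewrite lee_fin; case/andP: (hU x) => *; rewrite exprn_ile1.
by rewrite integral_cst // mul1e; exact: fin_num_fun_lty.
Qed.

Lemma unit_Lfun1 U : measurable_fun setT U -> unit_valued U -> U \in Lfun P 1%:E.
Proof. by move=> mU hU; apply: (Lfun_subset12 P_fin); exact: unit_Lfun2. Qed.

Lemma meanE U : mean P U = fine 'E_P[U].
Proof. by rewrite /mean expectation.unlock. Qed.

Lemma unit_mean U : measurable_fun setT U -> unit_valued U ->
  (\int[P]_x (U x)%:E)%E = (mean P U)%:E.
Proof.
move=> mU hU; rewrite /mean fineK //; have := expectation_fin_num (unit_Lfun1 mU hU).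
by rewrite expectation.unlock.
Qed.

Lemma unit_mean_ge0 U : unit_valued U -> 0 <= mean P U.
Proof.
by move=> hU; rewrite /mean fine_ge0 // integral_ge0 // => x _; rewrite lee_fin;
  case/andP: (hU x).
Qed.

Lemma unit_mean_le U V : measurable_fun setT U -> unit_valued U ->
  measurable_fun setT V -> unit_valued V -> (forall x, U x <= V x) ->
  mean P U <= mean P V.
Proof.
move=> mU hU mV hV le; rewrite -lee_fin -!unit_mean //.
apply: ge0_le_integral => //; try exact/measurable_EFinP.
- by move=> x _; rewrite lee_fin; case/andP: (hU x).
- by move=> x _; rewrite lee_fin.
Qed.

Lemma unit_mul U V : unit_valued U -> unit_valued V -> unit_valued (U \* V).
Proof.
move=> hU hV x; case/andP: (hU x) => *; case/andP: (hV x) => *.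
by rewrite /= mulr_ge0 // mulr_ile1.
Qed.

Lemma unit_covE U V : measurable_fun setT U -> unit_valued U ->
  measurable_fun setT V -> unit_valued V ->
  cov P U V = mean P (U \* V) - mean P U * mean P V.
Proof.
move=> mU hU mV hV; rewrite covE !meanE.
have l1U := unit_Lfun1 mU hU; have l1V := unit_Lfun1 mV hV.
have l1UV : (U * V) \in Lfun P 1%:E.
  by apply: unit_Lfun1; [exact: measurable_funM|exact: unit_mul].
rewrite covarianceE // fineB ?fin_numM ?expectation_fin_num //.
by rewrite fineM ?expectation_fin_num.
Qed.

Lemma unit_var_le U : measurable_fun setT U -> unit_valued U ->
  cov P U U <= mean P U.
Proof.
move=> mU hU; rewrite unit_covE // lerBlDr.
apply: le_trans (_ : mean P U <= _); last by rewrite lerDl mulr_ge0 // unit_mean_ge0.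
apply: unit_mean_le => //; [exact: measurable_funM|exact: unit_mul|].
by move=> x /=; case/andP: (hU x) => ? ?; rewrite ler_piMr.
Qed.

(** Both variances are at most the common mean, hence so is the product of their square roots, and
    the covariance is at most [rho] times the mean. *)
Lemma mixing_mean_mul B D U V (rho : R) : B `<=` measurable -> D `<=` measurable ->
  L2sub P B U -> L2sub P D V -> unit_valued U -> unit_valued V ->
  0 <= rho -> rho_corr P B D <= rho -> mean P U = mean P V ->
  mean P (U \* V) <= mean P U ^+ 2 + rho * mean P U.
Proof.
move=> sB sD hU hV uU uV rho0 hrho eUV.
have mf G W : G `<=` measurable -> L2sub P G W -> measurable_fun setT W.
  by move=> sG [mW _] _ Y mY; rewrite setTI; apply: sG; exact: mW.
have mU := mf _ _ sB hU; have mV := mf _ _ sD hV.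
have := abs_cov_rho sB sD hU hV rho0 hrho.
move/(le_trans (ler_norm _)); rewrite unit_covE // lerBlDr addrC -eUV -expr2.
move/le_trans; apply; rewrite lerD2l ler_wpM2l //.
have U0 := unit_mean_ge0 uU.
rewrite -[leRHS]sqr_sqrtr // expr2.
apply: ler_pM; rewrite ?sqrtr_ge0 // ler_wsqrtr //; first exact: unit_var_le.
by rewrite eUV; exact: unit_var_le.
Qed.

End Correlation.

(** * Rate of convergence *)

Section NonMeasurableBound.
Context {R : realType} {dO : measure_display} {Omega : measurableType dO}.
Import HBNNSimple.

(* The trace norm is only used through an upper bound, so its measurability is
   never needed: an integral of a nonnegative function is a supremum over the
   simple functions below it. *)
Lemma ge0_le_integral_ae (mu : {measure set Omega -> \bar R}) (f g : Omega -> \bar R) :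
  (forall x, (0 <= f x)%E) -> (forall x, (0 <= g x)%E) -> measurable_fun setT g ->
  {ae mu, forall x, (f x <= g x)%E} ->
  (\int[mu]_x f x <= \int[mu]_x g x)%E.
Proof.
move=> f0 g0 mg fg; rewrite ge0_integralTE //.
apply: ge_ereal_sup => _ [h /= hf <-].
rewrite -integralT_nnsfun //; apply: ae_ge0_le_integral => //.
- by move=> x _; rewrite lee_fin.
- by apply/measurable_EFinP; exact: measurable_funTS.
- by apply: filterS fg => x fgx _; exact: le_trans (hf x) fgx.
Qed.

End NonMeasurableBound.

(** * Products of contraction factors over separated blocks *)

Section Blocks.
Context {R : realType} {dO : measure_display} {Omega : measurableType dO}.
Local Notation C := R[i].
Variables (P : probability Omega R) (d : nat) (A : finType)
  (theta thetainv : Omega -> Omega) (T : A -> Omega -> 'M[C]_d -> 'M[C]_d).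
Hypothesis theta_meas : measurable_fun setT theta.
Hypothesis thetainv_meas : measurable_fun setT thetainv.
Hypothesis theta_pres : forall E, measurable E -> P (theta @^-1` E) = P E.
Hypothesis hT : forall a w, posmap (T a w).
Hypothesis T_meas : forall a X, mx_measurable (fun w => T a w X).
Variables (N k L : nat) (q : R).
Hypothesis qE : q = 1 - d%:R * k.+1%:R^-1.
Hypothesis q01 : 0 <= q <= 1.
Hypothesis NL : (N <= L)%N.

Definition block_factor w : R := if w \in floor_event theta T N k then q else 1.

(** Block [i] sees the times [i L + 1] to [i L + N], so [L - N] times are left out between
    consecutive blocks. *)
Definition block_prod c w : R := \prod_(i < c) block_factor (iter (i * L) theta w).

Lemma unit_block_factor : unit_valued block_factor.
Proof. by move=> w; rewrite /block_factor; case: ifP => // _; rewrite ler01 lexx. Qed.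

Lemma unit_block_prod c : unit_valued (block_prod c).
Proof.
move=> w; rewrite /block_prod; apply/andP; split.
  by apply: prodr_ge0 => i _; case/andP: (unit_block_factor (iter (i * L) theta w)).
by apply: prodr_ile1 => i _; exact: unit_block_factor.
Qed.

Lemma block_prodD c e w :
  block_prod (c + e) w = block_prod c w * block_prod e (iter (c * L) theta w).
Proof.
rewrite /block_prod big_split_ord /=.
by under [X in _ = _ * X]eq_bigr do rewrite -iterD addnC -mulnDl.
Qed.

(** The source space is arbitrary so that it can carry the full sigma-algebra or one generated by a
    window of times containing the blocks. *)
Lemma measurable_block_prod (disp : measure_display) (X : measurableType disp)
    (h : X -> Omega) c :
  (forall i, (i < c)%N -> forall j a Y, (1 <= j <= N)%N ->
    clM (fun f : X -> R => measurable_fun setT f)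
        (fun x => T a (iter (j + i * L) theta (h x)) Y)) ->
  measurable_fun setT (fun x => block_prod c (h x)).
Proof.
elim: c => [|c IH] hc.
  rewrite (_ : (fun x => _) = (fun=> 1)); first exact: measurable_cst.
  by apply/funext => x; rewrite /block_prod big_ord0.
rewrite (_ : (fun x => _) = (fun x => block_prod c (h x))
    \* (fun x => block_factor (iter (c * L) theta (h x)))); last first.
  by apply/funext => x; rewrite /block_prod big_ord_recr.
apply: measurable_funM; first by apply: IH => i ic; apply: hc; exact: leqW.
apply: measurable_fun_ifT => //.
apply: (measurable_fun_bool true); rewrite setTI.
rewrite (_ : _ @^-1` _ = [set x | floor_ge (k.+1%:R^-1)%:C%C
    (Phin theta T N (iter (c * L) theta (h x)))]); last first.
  by apply/seteqP; split => x /= hx; [exact: set_mem hx|exact: mem_set].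
apply: measurable_floor => [x|Y]; first exact: posmap_Phin.
apply: (clM_Phin hT (h := fun x => iter (c * L) theta (h x))) => [|i a Z hi].
  exact: fun_alg_measurable.
by have := hc c (ltnSn c) i a Z hi; rewrite (_ : (fun x => T a (iter (i + c * L)
  theta (h x)) Z) =
  (fun x => T a (iter i theta (iter (c * L) theta (h x))) Z)) //; apply/funext => x;
    rewrite iterD.
Qed.

Lemma measurable_thetaZ j : measurable_fun setT (thetaZ theta thetainv j).
Proof. by case: j => n; exact: measurable_iter. Qed.

Lemma instr_sub J : <<s instrG theta thetainv T J >> `<=` measurable.
Proof.
apply: smallest_sub; first exact: sigma_algebra_measurable.
move=> S [j [a [X [p [q' [B [_ [mB hS]]]]]]]].
have [m1 m2] := T_meas a X p q'.
case: hS => ->; rewrite -[_ @^-1` _]setTI.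
  exact: (measurableT_comp m1 (measurable_thetaZ j)).
exact: (measurableT_comp m2 (measurable_thetaZ j)).
Qed.

Lemma instr_clM J (j : nat) a Y : J j%:Z ->
  clM (fun f : g_sigma_algebraType (instrG theta thetainv T J) -> R => measurable_fun
    setT f)
      (fun x => T a (iter j theta x) Y).
Proof.
move=> Jj p r; split => _ B mB; rewrite setTI; apply: sub_sigma_algebra;
  exists j%:Z, a, Y, p, r, B; split => //; split => //; [left|right]; by [].
Qed.

Lemma L2sub_block_prod J n c :
  (forall i, (i < c)%N -> forall j, (1 <= j <= N)%N -> J (j + i * L + n)%N%:Z) ->
  L2sub P <<s instrG theta thetainv T J >> (fun w => block_prod c (iter n theta w)).
Proof.
move=> hJ.
have mG : measurable_fun setT
    (fun w : g_sigma_algebraType (instrG theta thetainv T J) => block_prod c (iter n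
      theta w)).
  apply: (@measurable_block_prod _ (g_sigma_algebraType (instrG theta thetainv T J))
    (iter n theta) c) => i ic j a Y hj.
  have := instr_clM a Y (hJ i ic j hj).
  by rewrite (_ : (fun x => _) = (fun x => T a (iter (j + i * L) theta (iter n theta
    x)) Y)) //;
     apply/funext => x; rewrite iterD.
split => [Y mY|]; first by have := mG measurableT Y mY; rewrite setTI.
have mO : measurable_fun setT (fun w => block_prod c (iter n theta w)).
  by move=> _ Y mY; apply: (@instr_sub J); exact: mG.
have := unit_Lfun2 P mO (fun w => unit_block_prod c (iter n theta w)).
by move/Lfun2_integrable_sqr/integrableP => [_]; apply: le_lt_trans;
   rewrite le_eqVlt; apply/orP; left; apply/eqP; apply: eq_integral => x _ /=;
   rewrite ger0_norm // exprn_even_ge0.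
Qed.

Lemma measurable_block_prod_iter c n :
  measurable_fun setT (fun w => block_prod c (iter n theta w)).
Proof.
apply: (measurable_block_prod (h := iter n theta)) => i _ j a Y _ p r.
have mi : measurable_fun setT (fun w => iter (j + i * L) theta (iter n theta w)).
  exact: (measurableT_comp (measurable_iter theta_meas _) (measurable_iter theta_meas
    n)).
by have [h1 h2] := T_meas a Y p r; split;
  [exact: (measurableT_comp h1 mi)|exact: (measurableT_comp h2 mi)].
Qed.

Lemma mean_iter (U : Omega -> R) n : measurable_fun setT U -> unit_valued U ->
  mean P (fun w => U (iter n theta w)) = mean P U.
Proof.
move=> mU hU; congr fine.
have mi := measurable_iter theta_meas n.
transitivity (\int[pushforward P (iter n theta)]_x (U x)%:E)%E.
  rewrite (ge0_integral_pushforward mi) ?preimage_setT //.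
    exact/measurable_EFinP.
  by move=> x _; rewrite lee_fin; case/andP: (hU x).
by apply: eq_measure_integral => E mE _; exact: (iter_preserving theta_meas theta_pres).
Qed.

Lemma rhoP_ub n K : rho_corr P (Fpast theta thetainv T K%:Z) (Ffut theta thetainv T
  (K + n)%N%:Z)
  <= rhoP P theta thetainv T n.
Proof.
apply: ub_le_sup; last by exists K.
by exists 1 => r [m ->]; apply: rho_corr_le1; exact: instr_sub.
Qed.

Lemma block_mean_double (rho : R) c : (0 < c)%N -> 0 <= rho ->
  rhoP P theta thetainv T (L - N).+1 <= rho ->
  mean P (block_prod (c + c)) <= mean P (block_prod c) ^+ 2 + rho * mean P
    (block_prod c).
Proof.
(* [K] is the last time seen by the first [c] blocks; the window of the others starts at time
   [c L + 1], which is [K + (L - N) + 1]. By stationarity both halves have the same mean. *)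
move=> c0 rho0 hrho; set K := (c.-1 * L + N)%N.
have KL : (K + (L - N).+1 = c * L + 1)%N.
  by rewrite /K -addnA addnS subnKC // addn1 addnS -mulSnr prednK.
have mB := measurable_block_prod_iter c 0.
have <- : block_prod c \* (fun w => block_prod c (iter (c * L) theta w)) = block_prod
  (c + c).
  by apply/funext => w; rewrite block_prodD.
have hU : L2sub P (Fpast theta thetainv T K%:Z) (block_prod c).
  apply: (@L2sub_block_prod _ 0) => i ic j /andP[_ jN] /=.
  by rewrite lez_nat addn0 addnC leq_add // leq_mul2r -ltnS prednK // ic orbT.
have hV : L2sub P (Ffut theta thetainv T (K + (L - N).+1)%N%:Z)
    (fun w => block_prod c (iter (c * L) theta w)).
  apply: L2sub_block_prod => i ic j /andP[j1 _] /=.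
  by rewrite lez_nat KL [X in (_ <= X)%N]addnC leq_add2l addn_gt0 j1.
have hr : rho_corr P (Fpast theta thetainv T K%:Z)
    (Ffut theta thetainv T (K + (L - N).+1)%N%:Z) <= rho.
  by apply: le_trans hrho; exact: rhoP_ub.
have hm : mean P (block_prod c) = mean P (fun w => block_prod c (iter (c * L) theta w)).
  exact: esym (mean_iter (c * L) mB (unit_block_prod c)).
exact: (mixing_mean_mul (@instr_sub _) (@instr_sub _) hU hV (unit_block_prod c)
  (fun w => unit_block_prod c (iter (c * L) theta w)) rho0 hr hm).
Qed.

Lemma block_mean1 : mean P (block_prod 1) <= 1 - (1 - q) * fine (P (floor_event theta
  T N k)).
Proof.
have mE := measurable_floor_event hT theta_meas T_meas N k.
have fE : P (floor_event theta T N k) \is a fin_num by exact: fin_num_measure.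
have mB := measurable_block_prod_iter 1 0.
rewrite -lee_fin -unit_mean //; last exact: unit_block_prod.
have hX w : block_prod 1 w = 1 - (1 - q) * \1_(floor_event theta T N k) w.
  rewrite /block_prod big_ord1 mul0n /= /block_factor indicE.
  by case: ifP => _; rewrite ?mulr1 ?mulr0 ?subr0 // opprB addrC subrK.
under eq_integral do rewrite hX EFinB.
have iI : P.-integrable setT (fun w => ((1 - q) * \1_(floor_event theta T N k) w)%:E).
  apply: (eq_integrable measurableT (fun w => (1 - q)%:E * (\1_(floor_event theta T N
    k) w)%:E)%E) => //.
  by apply: integrableZl => //; exact: integrable_indic.
rewrite integralB //; last exact: finite_measure_integrable_cst.
rewrite [X in (X - _ <= _)%E](_ : _ = 1%E); last first.
  by rewrite integral_cst // mul1e; exact: probability_setT.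
under [X in (_ - X)%E]eq_integral do rewrite EFinM.
rewrite integralZl //; last exact: integrable_indic.
by rewrite integral_indic // setIT [X in (_ <= X)%E]EFinB [X in (_ <= _ - X)%E]EFinM
  (fineK fE).
Qed.

(** The evolution splits into the previous blocks, one stretch of [N] steps that gains [q] on the
    floor event, and a remainder with constant [1]. *)
Lemma contr_block_prod w c : (forall j, tpres (fun X => \sum_a T a (iter j theta w)
  X)) ->
  forall n, (c * L <= n)%N -> contr (block_prod c w)%:C%C (Phin theta T n w).
Proof.
move=> tp.
have tpi n m : tpres (Phin theta T n (iter m theta w)).
  by apply: tpres_Phin => j X; rewrite -iterD; exact: tp.
have ctp n m : contr 1 (Phin theta T n (iter m theta w)).
  by apply: contr1; [exact: posmap_Phin|exact: tpi].
have split n m X : (m <= n)%N -> Phin theta T n w X =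
    Phin theta T (n - m) (iter m theta w) (Phin theta T m w X).
  by move=> mn; rewrite -PhinD subnKC.
elim: c => [|c IH] n hn.
  by rewrite /block_prod big_ord0; exact: (ctp n 0%N).
have hn2 : (c * L + N <= n)%N by apply: leq_trans hn; rewrite mulSnr leq_add2l.
have hn1 : (c * L <= n)%N by apply: leq_trans hn2; exact: leq_addr.
rewrite (_ : Phin theta T n w = Phin theta T (n - (c * L + N)) (iter (c * L + N)
  theta w) \o
  (Phin theta T N (iter (c * L) theta w) \o Phin theta T (c * L) w)); last first.
  by apply/funext => X /=; rewrite (split _ _ _ hn2) (PhinD _ _ (c * L)).
rewrite -[X in contr X]mul1r; apply: contr_comp; first exact: ctp.
rewrite /block_prod big_ord_recr /= mulrC rmorphM.
apply: contr_comp; last exact: IH.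
rewrite /block_factor; case: ifPn => [/set_mem hE|_]; last exact: ctp.
rewrite qE rmorphB rmorphM rmorph1 rmorph_nat; apply: contr_floor => //.
exact: posmap_Phin.
Qed.

End Blocks.

(** * Decay of recursive sequences and summability *)

Section Numeric.
Context {R : realType}.

(* The quadratic term makes [a j] eventually smaller than [rho]; from then on each
   doubling multiplies it by at most [2 * rho], which is as small as desired. *)
Lemma doubling_decay (a : nat -> R) (rho z : R) :
  (forall j, 0 <= a j <= 1) -> a 0%N < 1 ->
  (forall j, a j.+1 <= a j ^+ 2 + rho * a j) ->
  0 <= rho -> rho <= (1 - a 0%N) / 2 -> 0 < z <= 1 -> rho <= z / 2 ->
  exists2 D, 0 <= D & forall j, a j <= D * z ^+ j.
Proof.
move=> a01 a1 rec rho0 rhoa /andP[z0 z1] rhoz.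
(* The midpoint of [a 0] and [1]: the bound on [rho] keeps the initial factors [a 0 + rho] below
   it. *)
pose y := (1 + a 0%N) / 2.
have a0 j : 0 <= a j by case/andP: (a01 j).
have y1 : y < 1 by rewrite /y; lra.
have y0 : 0 <= y by rewrite /y; have := a0 0%N; lra.
have step j (u : R) : a j <= u -> a j.+1 <= a j * (u + rho).
  move=> au; apply: le_trans (rec j) _; rewrite mulrDr expr2 [rho * _]mulrC lerD2r.
  by rewrite ler_wpM2l.
have decay j : a j <= a 0%N * y ^+ j.
  elim: j => [|j IH]; first by rewrite expr0 mulr1.
  have aj : a j <= a 0%N.
    by apply: le_trans IH _; rewrite ler_piMr // exprn_ile1 // ltW.
  apply: le_trans (step j _ aj) _.
  rewrite exprSr mulrA; apply: ler_pM => //; first by rewrite addr_ge0.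
  by rewrite /y; lra.
have [J hJ] : exists J, forall j, (J <= j)%N -> a j <= z / 2.
  have /cvgr0Pnorm_le cq : y ^+ n @[n --> \oo] --> 0 by apply: cvg_expr; rewrite
    ger0_norm.
  have [|J _ h] := cq (z / 2); first by rewrite divr_gt0.
  exists J => j Jj; apply: le_trans (decay j) _; apply: le_trans (h j Jj) => /=.
  by apply: le_trans (ler_norm _); rewrite ler_piMl ?exprn_ge0 // ltW.
have late i : a (J + i)%N <= z ^+ i.
  elim: i => [|i IH]; first by rewrite expr0; case/andP: (a01 (J + 0)%N).
  rewrite addnS exprSr; apply: le_trans (step _ _ (hJ _ (leq_addr i J))) _.
  by apply: ler_pM => //; [rewrite addr_ge0 // divr_ge0 // ltW|lra].
(* From [J] on each step gains a factor [z]; before [J] the constant [z^-J] compensates the trivial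
   bound [a j <= 1]. *)
exists (z ^- J) => [|j]; first by rewrite invr_ge0 exprn_ge0 // ltW.
rewrite mulrC; have zJ : 0 < z ^+ J by rewrite exprn_gt0.
have [Jj|jJ] := leqP J j.
  by rewrite -(subnKC Jj) exprD mulrAC mulfV ?gt_eqF // mul1r late.
rewrite ler_pdivlMr //; apply: le_trans (_ : 1 * z ^+ J <= _).
  by rewrite ler_wpM2r ?(ltW zJ) //; case/andP: (a01 j).
by rewrite mul1r; apply: ler_wiXn2l; rewrite ?(ltW z0) ?(ltnW jJ).
Qed.

(** Telescoping: [1/n^2 <= 2 (1/n - 1/(n+1))] for [n >= 1]. The subtracted term is what lets the
    induction close. *)
Lemma sum_inv_sqr_le (M : nat) :
  \sum_(1 <= n < M.+1) (n%:R^-1) ^+ 2 <= 2 - 2 * (M.+1%:R)^-1 :> R.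
Proof.
elim: M => [|M IH]; first by rewrite big_geq // invr1 mulr1 subrr.
rewrite big_nat_recr //=; apply: le_trans (lerD IH (lexx _)) _.
set x : R := M.+1%:R; have x1 : 1 <= x by rewrite /x ler1n.
have -> : M.+2%:R = x + 1 :> R by rewrite /x -natr1.
have x0 : 0 < x by apply: lt_le_trans x1.
have x0' : 0 < x + 1 by rewrite addr_gt0.
rewrite -subr_ge0.
have -> : 2 - 2 * (x + 1)^-1 - (2 - 2 * x^-1 + x^-1 ^+ 2)
  = (x - 1) / (x ^+ 2 * (x + 1)) by field; rewrite !gt_eqF.
by rewrite divr_ge0 ?subr_ge0 // mulr_ge0 ?exprn_ge0 // ltW.
Qed.

Lemma summable_power (D p : R) (K : nat) : 0 <= D -> 0 < p -> 2 <= K%:R * p ->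
  (\sum_(1 <= n <oo) ((D * (n%:R^-1) ^+ K) `^ p)%:E < +oo)%E.
Proof.
move=> D0 p0 Kp.
have term n : (1 <= n)%N -> (D * (n%:R^-1) ^+ K) `^ p <= D `^ p * (n%:R^-1) ^+ 2.
  move=> n1; have ni0 : 0 < n%:R^-1 :> R by rewrite invr_gt0 ltr0n.
  have ni1 : n%:R^-1 <= 1 :> R by rewrite invf_le1 ?ltr0n // ler1n.
  rewrite powRM // ?exprn_ge0 ?(ltW ni0) // ler_wpM2l ?powR_ge0 //.
  rewrite -powR_mulrn ?(ltW ni0) // -powRrM -powR_mulrn ?(ltW ni0) //.
  by apply: ger_powR; rewrite ?ni0.
apply: (@le_lt_trans _ _ (D `^ p * 2)%:E); last exact: ltry.
apply: lime_le.
  by apply: is_cvg_nneseries => n _ _; rewrite lee_fin powR_ge0.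
apply: nearW => -[|M]; first by rewrite big_geq // lee_fin mulr_ge0 // powR_ge0.
rewrite sumEFin lee_fin.
apply: le_trans (_ : \sum_(1 <= n < M.+1) D `^ p * (n%:R^-1) ^+ 2 <= _).
  by apply: ler_sum_nat => n /andP[n1 _]; exact: term.
rewrite -mulr_sumr ler_wpM2l ?powR_ge0 //; apply: le_trans (sum_inv_sqr_le M) _.
by rewrite gerBl mulr_ge0 // invr_ge0.
Qed.

(** Turns geometric decay in the number [j] of doublings into polynomial decay in the time [n],
    since [2^-j <= 2 L / n]. *)
Lemma dyadic_scale (L n K j : nat) : (0 < n)%N -> (n < 2 ^ j.+1 * L)%N ->
  (2 ^- K) ^+ j <= ((2 * L)%:R / n%:R) ^+ K :> R.
Proof.
move=> n0 hn.
rewrite -exprVn exprAC; apply: lerXn2r; rewrite ?nnegrE ?exprn_ge0 ?divr_ge0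
  ?invr_ge0 //.
rewrite exprVn ler_pdivlMr ?ltr0n // mulrC ler_pdivrMr ?exprn_gt0 //.
by rewrite -natrX -natrM ler_nat mulnAC -expnS; exact: ltnW.
Qed.

End Numeric.

(** * Choice of the parameters and the summable bound *)

Section Rate.
Context {R : realType} {dO : measure_display} {Omega : measurableType dO}.
Local Notation C := R[i].
Variables (P : probability Omega R) (d : nat) (A : finType)
  (theta thetainv : Omega -> Omega) (T : A -> Omega -> 'M[C]_d -> 'M[C]_d).
Hypothesis d_gt0 : (0 < d)%N.
Hypothesis theta_meas : measurable_fun setT theta.
Hypothesis thetainv_meas : measurable_fun setT thetainv.
Hypothesis theta_pres : forall E, measurable E -> P (theta @^-1` E) = P E.
Hypothesis hT : forall a w, posmap (T a w).
Hypothesis T_meas : forall a X, mx_measurable (fun w => T a w X).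
Hypothesis Phi_tp : {ae P, forall w, trace_preserving (fun X => \sum_(a : A) T a w X)}.

Lemma unit_mean_le1 (U : Omega -> R) : measurable_fun setT U -> unit_valued U ->
  mean P U <= 1.
Proof.
move=> mU hU.
have -> : 1 = mean P (fun=> 1).
  by rewrite meanE expectation_cst.
apply: unit_mean_le => //; first by move=> x; rewrite ler01 lexx.
by move=> x; case/andP: (hU x).
Qed.

(** An event of positive probability contains a point with a trace-preserving orbit; at that point
    the factor is a contraction constant for states, hence nonnegative. *)
Lemma floor_event_factor_ge0 N k : P (floor_event theta T N k) != 0%E ->
  0 <= 1 - d%:R * k.+1%:R^-1 :> R.
Proof.
move=> E0; have mE := measurable_floor_event hT theta_meas T_meas N k.
have [Z [mZ Z0 hZ]] := ae_orbit theta_meas theta_pres Phi_tp.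
have [w Ew tp] : exists2 w, floor_event theta T N k w &
    forall j, tpres (fun X => \sum_a T a (iter j theta w) X).
  apply: contrapT => h; move/eqP: E0; apply; apply/eqP.
  rewrite eq_le measure_ge0 andbT -Z0; apply: le_measure; rewrite ?inE //.
  by move=> w Ew; apply: hZ => tp; apply: h; exists w.
have hc := contr_floor (posmap_Phin theta hT N w) (tpres_Phin N tp) Ew.
have := close_ge0 (hc _ _ _ (close_states (@rho0_pos R d) (@rho0_pos R d)
  (rho0_tr d_gt0) (rho0_tr d_gt0))).
have -> : (1 - d%:R * (k.+1%:R^-1)%:C%C) * 1 = (1 - d%:R * k.+1%:R^-1 : R)%:C%C.
  by rewrite mulr1 rmorphB rmorphM rmorph1 rmorph_nat.
by rewrite ler0c.
Qed.

(** By invariance [s (theta^n w)] is the image of [s w], so two images of states under the same map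
    are compared. *)
Lemma tnorm_integral_le N k L q s c n vt :
  q = 1 - d%:R * k.+1%:R^-1 -> 0 <= q <= 1 -> (N <= L)%N ->
  dyn_stationary theta T P s -> random_state vt -> (c * L <= n)%N ->
  (\int[P]_w (tnorm (Phin theta T n w (vt w) - s (iter n theta w)))%:E
    <= (2 * d%:R ^+ 2 * mean P (block_prod theta T N k L q c))%:E)%E.
Proof.
move=> qE q01 NL [[_ st] inv] [_ hvt] cn.
have mB : measurable_fun setT (block_prod theta T N k L q c).
  exact: (measurable_block_prod_iter theta_meas hT T_meas N k L q c 0).
have uB := unit_block_prod theta T N k L q01 c.
rewrite EFinM -unit_mean // -ge0_integralZl_EFin //; last 2 first.
- by move=> x _; rewrite lee_fin; case/andP: (uB x).
- exact/measurable_EFinP.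
apply: ge0_le_integral_ae.
- by move=> x; rewrite lee_fin tnorm_ge0.
- by move=> x; rewrite lee_fin !mulr_ge0 ?exprn_ge0 //; case/andP: (uB x).
- by apply/measurable_EFinP; apply: measurable_funM => //; exact: measurable_cst.
apply: filterS2 inv (ae_orbit theta_meas theta_pres Phi_tp) => w hinv tp.
rewrite lee_fin -hinv; apply: tnorm_close.
have [p1 t1] := hvt w; have [p2 t2] := st w.
have := contr_block_prod hT qE NL tp cn (close_states p1 p2 t1 t2).
by rewrite mulr1.
Qed.

Lemma stationary_rate N k s delta :
  P (floor_event theta T N k) != 0%E -> dyn_stationary theta T P s ->
  (rhoP P theta thetainv T n @[n --> \oo] --> 0%R) -> 0 < delta ->
  exists r : nat -> R,
    (forall n : nat, (1 <= n)%N -> 0 <= r n) /\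
    (\sum_(1 <= n <oo) ((r n) `^ (delta / (2 + delta)))%:E < +oo)%E /\
    (forall vt : Omega -> 'M[R[i]]_d, random_state vt ->
       forall n : nat, (1 <= n)%N ->
         (\int[P]_w (tnorm (Phin theta T n w (vt w) - s (iter n theta w)))%:E
            <= (r n)%:E)%E).
Proof.
move=> E0 hs hrho delta0.
pose p := delta / (2 + delta).
have p0 : 0 < p by rewrite divr_gt0 // addr_gt0.
(* The bound will be of order [n^-K], and [K p >= 2] makes its [p]-th power at most of order
   [n^-2]. *)
pose K := (Num.truncn (2 / p)).+1.
have Kp : 2 <= K%:R * p.
  by rewrite -ler_pdivrMr //; apply: ltW; exact: truncnS_gt.
have mE := measurable_floor_event hT theta_meas T_meas N k.
pose e := fine (P (floor_event theta T N k)).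
have e0 : 0 < e.
  rewrite /e fine_gt0 // lt_neqAle eq_sym E0 measure_ge0 /=.
  by apply: le_lt_trans (probability_le1 _ mE) _; exact: ltry.
pose q : R := 1 - d%:R * k.+1%:R^-1.
have q1 : q < 1 by rewrite gtrBl mulr_gt0 ?ltr0n // invr_gt0 ltr0n.
have q01 : 0 <= q <= 1 by rewrite (floor_event_factor_ge0 E0) ltW.
(* A factor [2^-K] for each doubling of the number of blocks means decay of order [K] in that
   number. *)
pose z : R := 2 ^- K.
have z01 : 0 < z <= 1.
  by rewrite /z invr_gt0 exprn_gt0 //= invf_le1 ?exprn_gt0 // exprn_ege1 // ler1n.
have z0 : 0 < z by case/andP: z01.
(* The two smallness conditions of [doubling_decay], the second one because
   [(1 - q) e <= 1 - a 0]. *)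
pose rho := Num.min (z / 2) ((1 - q) * e / 2).
have rho0 : 0 < rho by rewrite lt_min !divr_gt0 // mulr_gt0 // subr_gt0.
have [m0 hm0] : exists m0, forall m, (m0 <= m)%N -> rhoP P theta thetainv T m <= rho.
  have /cvgr0Pnorm_le/(_ _ rho0) [m0 _ h] := hrho.
  by exists m0 => m hm; apply: le_trans (h m hm); exact: ler_norm.
(* The separation [(L - N) + 1] then exceeds [m0], so correlations across a cut are at most [rho];
   moreover [L] is positive. *)
pose L := (N + m0).+1.
have NL : (N <= L)%N by rewrite /L leqW // leq_addr.
pose B c := block_prod theta T N k L q c.
have mB c : measurable_fun setT (B c).
  exact: (measurable_block_prod_iter theta_meas hT T_meas N k L q c 0).
have uB c : unit_valued (B c) := unit_block_prod theta T N k L q01 c.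
pose a j := mean P (B (2 ^ j)%N).
have a01 j : 0 <= a j <= 1 by rewrite unit_mean_ge0 // unit_mean_le1.
have ha0 : a 0%N <= 1 - (1 - q) * e.
  by rewrite /a expn0; apply: block_mean1.
have qe0 : 0 < (1 - q) * e by rewrite mulr_gt0 // subr_gt0.
have [D D0 hD] : exists2 D, 0 <= D & forall j, a j <= D * z ^+ j.
  apply: (@doubling_decay _ a rho) => //.
  - by apply: le_lt_trans ha0 _; rewrite gtrBl.
  - move=> j; rewrite /a expnS mul2n -addnn.
    have c0 : (0 < 2 ^ j)%N by rewrite expn_gt0.
    apply: (block_mean_double theta_meas thetainv_meas theta_pres hT T_meas k q01 NL
      c0 (ltW rho0)).
    by apply: hm0; rewrite /L subSn ?leq_addr // addKn leqW // leqW.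
  - exact: ltW.
  - by rewrite ge_min; apply/orP; right; rewrite ler_pM2r ?invr_gt0 // lerBrDr -lerBrDl.
  - by rewrite ge_min lexx.
(* [2 d^2] comes from the trace norm, [1 + D] covers both cases below, and [(2 L)^K] converts blocks
   into time steps. *)
pose D' := 2 * d%:R ^+ 2 * ((1 + D) * (2 * L)%:R ^+ K).
have D'0 : 0 <= D' by rewrite !mulr_ge0 ?exprn_ge0 // addr_ge0.
exists (fun n => D' * (n%:R^-1) ^+ K); split.
  by move=> n _; rewrite mulr_ge0 // exprn_ge0 // invr_ge0.
split; first exact: summable_power.
move=> vt hvt n n1.
have [c cn hc] : exists2 c, (c * L <= n)%N &
    mean P (B c) <= (1 + D) * ((2 * L)%:R / n%:R) ^+ K.
  have L0 : (0 < L)%N by [].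
  (* For [n < L] no block fits and the trivial bound [1] suffices, as [2 L / n >= 1]. Otherwise the
     number of blocks is the largest power of two not exceeding [n %/ L]. *)
  have [nL|Ln] := ltnP n L.
    exists 0%N => //; apply: le_trans (unit_mean_le1 (mB _) (uB _)) _.
    rewrite -[leLHS]mulr1; apply: ler_pM => //; first by rewrite lerDl.
    apply: exprn_ege1; rewrite ler_pdivlMr ?ltr0n // mul1r ler_nat.
    by apply: ltnW; apply: leq_trans nL _; rewrite leq_pmull.
  have nL0 : (0 < n %/ L)%N by rewrite divn_gt0.
  have /andP[j1 j2] := trunc_log_bounds (leqnn 2) nL0.
  set j := trunc_log 2 _ in j1 j2.
  exists (2 ^ j)%N.
    by apply: leq_trans (leq_trunc_div n L); rewrite leq_mul2r j1 orbT.
  apply: le_trans (hD j) _; apply: ler_pM => //; first by rewrite exprn_ge0 // ltW.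
    by rewrite lerDr.
  by apply: dyadic_scale => //; rewrite -ltn_divLR.
apply: le_trans (tnorm_integral_le (erefl q) q01 NL hs hvt cn) _.
rewrite lee_fin /D' -[leRHS]mulrA; apply: ler_wpM2l; first by rewrite mulr_ge0 //
  exprn_ge0.
by rewrite -mulrA -exprMn.
Qed.

End Rate.

Theorem theorem1
  (R : realType) (d : nat) (hd : (0 < d)%N)
  (A : finType) (a0 : A)
  (dO : measure_display) (Omega : measurableType dO)
  (P : probability Omega R)
  (theta thetainv : Omega -> Omega)
  (theta_meas : measurable_fun setT theta)
  (thetainv_meas : measurable_fun setT thetainv)
  (theta_inv1 : cancel theta thetainv) (theta_inv2 : cancel thetainv theta)
  (theta_pres : forall E : set Omega, measurable E -> P (theta @^-1` E) = P E)
  (theta_ergodic : forall E : set Omega, measurable E -> theta @^-1` E = E ->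
                     P E = 0%E \/ P E = 1%E)
  (T : A -> Omega -> 'M[R[i]]_d -> 'M[R[i]]_d)
  (T_lin : forall a w, linear (T a w))
  (T_cp : forall a w, completely_positive (T a w))
  (T_tni : forall a w, trace_nonincreasing (T a w))
  (T_meas : forall a (X : 'M[R[i]]_d), mx_measurable (fun w => T a w X))
  (Phi_tp : {ae P, forall w, trace_preserving (fun X => \sum_(a : A) T a w X)})
  (ESP : {ae P, forall w, exists N0 : nat, forall n : nat, (N0 <= n)%N ->
            strictly_positive (Phin theta T n w)}) :
  exists s : Omega -> 'M[R[i]]_d,
    dyn_stationary theta T P s /\
    (forall s' : Omega -> 'M[R[i]]_d, dyn_stationary theta T P s' ->
       {ae P, forall w, s' w = s w}) /\
    (forall vt : Omega -> 'M[R[i]]_d, random_state vt ->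
       {ae P, forall w, forall Q1 Q2 : probability (seqMeas a0) R,
          is_quenched_law theta T a0 (vt w) w Q1 ->
          is_quenched_law theta T a0 (s w) w Q2 ->
          Q1 `<< Q2}) /\
    ((rhoP P theta thetainv T n @[n --> \oo] --> 0%R) ->
     forall delta : R, 0 < delta ->
       exists r : nat -> R,
         (forall n : nat, (1 <= n)%N -> 0 <= r n) /\
         (\sum_(1 <= n <oo) ((r n) `^ (delta / (2 + delta)))%:E < +oo)%E /\
         (forall vt : Omega -> 'M[R[i]]_d, random_state vt ->
            forall n : nat, (1 <= n)%N ->
              (\int[P]_w (tnorm (Phin theta T n w (vt w) - s (iter n theta w)))%:E
                 <= (r n)%:E)%E)).
Proof.
have hT a w : posmap (T a w) by split; [exact: T_lin|exact: cp_pos].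
have [s [hs uniq]] := dyn_stationary_exists hd theta_meas thetainv_meas theta_inv1
  theta_inv2 theta_pres theta_ergodic hT T_meas Phi_tp ESP.
exists s; split => //; split => //; split.
  move=> vt [_ hvt].
  have pd := dyn_stationary_pd hd theta_meas thetainv_meas theta_inv1
    theta_inv2 theta_pres theta_ergodic hT T_meas ESP hs.
  apply: filterS pd => w [e e0 he] Q1 Q2 h1 h2.
  exact: (quenched_law_dominates hT e0 (hvt w) he h1 h2).
move=> hrho delta delta0.
have [N [k E0]] := floor_event_tail_gt0 hT theta_meas T_meas hd ESP.
(* [floor_event] contains [floor_event_tail], so it inherits positive probability. *)
have E1 : P (floor_event theta T N k) != 0%E.
  apply: contra_neq E0 => E1; apply/eqP; rewrite eq_le measure_ge0 andbT -E1.
  apply: le_measure; rewrite ?inE; [|exact: measurable_floor_event|by move=> w []].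
  exact: measurable_floor_event_tail.
exact: (stationary_rate hd theta_meas thetainv_meas theta_pres hT T_meas Phi_tp E1 hs
  hrho delta0).
Qed.
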